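(* Let $\Lambda\subset\mathbb{D}$ be discrete, $f:\mathbb{D}\setminus\Lambda\to\mathbb{C}$, and $\kappa\ge0$ an integer. Then: (1) If $\mathbf{k}_{2\kappa}(f)=\mathbf{k}_{2\kappa+3}(f)=\kappa$, then $f\in\mathcal{S}_\kappa$. (2) If $f\in\mathcal{S}_\kappa$, then $\mathbf{k}_{2\kappa}(f)=\kappa$.
   Context: $\mathbb{D}$ is the open unit disk; a set $\Lambda\subset\mathbb{D}$ is discrete if it is at most countable with accumulation points only on the unit circle. Pick matrix: $P_n(f;z_1,\dots,z_n)=\left[\frac{1-f(z_i)\overline{f(z_j)}}{1-z_i\overline{z_j}}\right]_{i,j=1}^n$ for distinct $z_i\in\mathrm{Dom}(f)$. $\mathrm{sq}_-P$ = number of negative eigenvalues (with multiplicity) of a Hermitian $P$. $\mathbf{k}_n(f)=\max\mathrm{sq}_-P_n(f;z_1,\dots,z_n)$ over distinct $z_1,\dots,z_n\in\mathrm{Dom}(f)$, and $\mathbf{k}_0(f)=0$. $\mathcal{S}_\kappa$: functions defined on $\mathbb{D}\setminus\Lambda$ for some discrete $\Lambda$ all of whose Pick matrices have at most $\kappa$ negative eigenvalues, with at least one Pick matrix having exactly $\kappa$. *)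

(* Defs.v *)
From HB Require Import structures.
From mathcomp Require Import all_boot all_order all_algebra.
From mathcomp Require Import boolp classical_sets cardinality reals.
From mathcomp Require Import complex.
Set Implicit Arguments. Unset Strict Implicit. Unset Printing Implicit Defensive.
Import Order.TTheory GRing.Theory Num.Theory.
Local Open Scope ring_scope.
Local Open Scope classical_set_scope.

Definition disk (R : realType) : set R[i] := [set z | `|z| < 1].
Arguments disk R : clear implicits.

Definition discrete_set (R : realType) (L : set R[i]) : Prop :=
  [/\ countable L, L `<=` disk R &
      forall w : R[i], disk R w ->
        exists2 r : R[i], 0 < r &
          forall l, L l -> l != w -> r <= `|l - w| ].

Definition pick_mx (R : realType) (n : nat) (f : R[i] -> R[i])
    (z : n.-tuple R[i]) : 'M[R[i]]_n :=
  \matrix_(i < n, j < n)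
    ((1 - f (tnth z i) * Num.conj (f (tnth z j)))
       / (1 - tnth z i * Num.conj (tnth z j))).

Lemma char_poly_splits (R : realType) (n : nat) (P : 'M[R[i]]_n) :
  exists s : seq R[i], char_poly P == \prod_(a <- s) ('X - a%:P).
Proof.
have [s Hs] := closed_field_poly_normal (char_poly P).
exists s; rewrite Hs.
by have /monicP -> := char_poly_monic P; rewrite scale1r.
Qed.

Definition eigenvalues (R : realType) (n : nat) (P : 'M[R[i]]_n) : seq R[i] :=
  xchoose (char_poly_splits P).

(* sq_- P : number of negative eigenvalues counted with multiplicity.
   (In R[i], [a < 0] means that a is a negative real number.) *)
Definition sq_minus (R : realType) (n : nat) (P : 'M[R[i]]_n) : nat :=
  count (fun a => a < 0) (eigenvalues P).

Definition pick_attains (R : realType) (Dom : set R[i]) (f : R[i] -> R[i])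
    (n k : nat) : Prop :=
  exists z : n.-tuple R[i],
    [/\ uniq z, (forall i, Dom (tnth z i)) & sq_minus (pick_mx f z) = k].

(* k_n(f) = max sq_- P_n(f; z_1..z_n) over distinct z_i in Dom(f)
   (note sq_- of an n x n matrix is at most n; k_0(f) = 0). *)
Definition kn (R : realType) (Dom : set R[i]) (f : R[i] -> R[i]) (n : nat)
    : nat :=
  \max_(k < n.+1 | `[< pick_attains Dom f n k >]) k.

Definition in_S (R : realType) (Dom : set R[i]) (f : R[i] -> R[i])
    (kappa : nat) : Prop :=
  [/\ exists L : set R[i], discrete_set L /\ Dom = disk R `\` L,
      (forall (n : nat) (z : n.-tuple R[i]),
          uniq z -> (forall i, Dom (tnth z i)) ->
          (sq_minus (pick_mx f z) <= kappa)%N) &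
      exists n : nat, pick_attains Dom f n kappa ].

(* Main.v *)
Require Import Defs.
From mathcomp Require Import all_boot all_order all_algebra.
From mathcomp Require Import sesquilinear spectral.
From mathcomp Require Import boolp classical_sets cardinality reals.
From mathcomp Require Import topology normedtype.
From mathcomp Require Import complex ring lra.
Import Order.TTheory GRing.Theory Num.Theory.
Import numFieldNormedType.Exports.
Local Open Scope ring_scope.
Local Open Scope classical_set_scope.
Local Open Scope sesquilinear_scope.
Set Implicit Arguments. Unset Strict Implicit. Unset Printing Implicit Defensive.

(** Write K for the Pick kernel of f. If P = K(Z,Z) is invertible on a finite set
    Z, the Schur complement K(y,w) - K(y,Z) P^-1 K(Z,w) has again Pick form: it
    equals a(y) K_g(y,w) conj(a(w)) with g = b/a a linear fractional transform of
    f whose coefficients are rational with poles only in Z. Negative squares of K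
    beyond those of P are negative squares of K_g.

    Everything then reduces to two facts about functions g on the disk minus a
    discrete set. (i) If all Pick matrices of size at most 3 are positive, then
    Schur transforms of g are Lipschitz, so g and its difference quotients are
    locally Lipschitz ([C11]). (ii) If |g| <= 1, g is Lipschitz at each point, and
    [C11] off a discrete set, then all Pick matrices are positive: this is the Schur
    algorithm, each step of which needs only the maximum principle. The latter
    comes from the fact that the mean of a [C11] function over the n-th roots of
    unity on a small circle of radius r differs from the value at the centre by
    o(1) r^2 as n grows, so that |g| + eps |z|^2 has no interior maximum.

    For (1), take a minimal subset Z of the 2 kappa points that still has kappa
    negative squares; minimality makes P invertible, the Schur complement is
    positive on triples, hence g is [C11] and the Schur complement is positive.
    For (2), a set with kappa negative squares shows in the same way that f is
    [C11] off a finite set. Starting from the empty set, add points two at a time,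
    gaining a negative square each time; when this is impossible, the
    corresponding g is Lipschitz and [C11] off a discrete set, so by (ii) no
    further negative square exists. *)

(** * Negative squares of Hermitian matrices *)

Definition qform (C : numClosedFieldType) n (P : 'M[C]_n) (v : 'rV[C]_n) : C :=
  (v *m P *m v^t*) 0 0.

Definition psd (C : numClosedFieldType) n (P : 'M[C]_n) : Prop :=
  forall v, 0 <= qform P v.

(** The rows of [V] span a [k]-dimensional subspace on which the form is negative definite;
    injectivity of [V] is automatic. Unlike a count of eigenvalues, this is easily carried through
    congruences. *)
Definition negsq (C : numClosedFieldType) n (P : 'M[C]_n) (k : nat) : Prop :=
  exists V : 'M[C]_(k, n), forall x : 'rV_k, x != 0 -> qform P (x *m V) < 0.

Lemma trCmx_mul (C : numClosedFieldType) m n p (A : 'M[C]_(m, n))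
  (B : 'M[C]_(n, p)) : (A *m B)^t* = B^t* *m A^t*.
Proof. by rewrite trmx_mul map_mxM. Qed.

Lemma qform_mul (C : numClosedFieldType) m n (P : 'M[C]_n) (S : 'M[C]_(m, n)) v :
  qform P (v *m S) = qform (S *m P *m S^t*) v.
Proof. by rewrite /qform trCmx_mul !mulmxA. Qed.

Lemma qform_real (C : numClosedFieldType) n (P : 'M[C]_n) v :
  P^t* = P -> qform P v \is Num.real.
Proof.
move=> hP; apply/CrealP; rewrite /qform.
transitivity (((v *m P *m v^t*)^t*) 0 0); first by rewrite !mxE.
by rewrite !trCmx_mul trmxCK hP mulmxA.
Qed.

Lemma not_psd (C : numClosedFieldType) n (P : 'M[C]_n) :
  P^t* = P -> ~ psd P -> exists v, qform P v < 0.
Proof.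
move=> hP /existsNP[v /negP]; rewrite -real_ltNge ?real0 ?qform_real// => ?.
by exists v.
Qed.

Lemma qform_diag (C : numClosedFieldType) n (d v : 'rV[C]_n) :
  qform (diag_mx d) v = \sum_i d 0 i * `|v 0 i| ^+ 2.
Proof.
rewrite /qform mxE; apply: eq_bigr => i _.
rewrite mul_mx_diag !mxE normCK; ring.
Qed.

Lemma negsq_le (C : numClosedFieldType) n (P : 'M[C]_n) k l :
  (l <= k)%N -> negsq P k -> negsq P l.
Proof.
move=> lk [V hV]; exists (pid_mx l *m V) => x x0; rewrite mulmxA; apply: hV.
apply: contraNneq x0 => /(congr1 (mulmx^~ (pid_mx l : 'M_(k,l)))).
by rewrite -mulmxA mul_pid_mx minnn (minn_idPr lk) pid_mx_1 mulmx1 mul0mx => ->.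
Qed.

Lemma char_poly_unitary_conj (C : numClosedFieldType) n (U D : 'M[C]_n) :
  U \is unitarymx -> char_poly (invmx U *m D *m U) = char_poly D.
Proof.
move=> uU; have uU' := unitarymx_unit uU.
rewrite /char_poly /char_poly_mx.
have -> : 'X%:M - map_mx polyC (invmx U *m D *m U) =
  map_mx polyC (invmx U) *m ('X%:M - map_mx polyC D) *m map_mx polyC U.
  rewrite mulmxBr mulmxBl !map_mxM /=; congr (_ - _).
  by rewrite mul_mx_scalar -scalemxAl -map_mxM mulVmx// map_mx1 scalemx1.
rewrite !det_mulmx mulrAC -det_mulmx -map_mxM mulVmx// map_mx1 det1.
by rewrite mul1r.
Qed.

(** [eigenvalues] is obtained by choice, so only its multiset is determined; unique factorization of
    the characteristic polynomial identifies it with the spectral diagonal. *)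
Lemma sq_minus_spectral (R : realType) n (P : 'M[R[i]]_n) : P \is normalmx ->
  sq_minus P = #|[set i | spectral_diag P 0 i < 0]%SET|.
Proof.
move=> nP; rewrite /sq_minus /eigenvalues.
have /eqP := xchooseP (char_poly_splits P); set s := xchoose _.
rewrite {1}(orthomx_spectralP nP) char_poly_unitary_conj ?spectral_unitarymx//.
rewrite char_poly_trig ?diag_mx_is_trig// => hs.
have /permP -> : perm_eq s [seq spectral_diag P 0 i | i <- enum 'I_n].
  apply: prod_XsubC_eq; rewrite -hs big_map big_enum.
  by apply: eq_bigr => i _; rewrite mxE eqxx.
by rewrite count_map cardsE cardE -size_filter enumT.
Qed.

(** Sylvester's law of inertia: after unitary diagonalization, the coordinate vectors at negative
    diagonal entries span a negative subspace, and a larger negative subspace would contain a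
    nonzero vector vanishing in all those coordinates. *)
Lemma sq_minusP (R : realType) n (P : 'M[R[i]]_n) k : P^t* = P ->
  (k <= sq_minus P)%N <-> negsq P k.
Proof.
move=> hP; have hs : P \is hermsymmx.
  by apply/is_hermitianmxP; rewrite expr0 scale1r hP.
have nP := hermitian_normalmx hs.
rewrite sq_minus_spectral//; set N := [set i | _]%SET.
pose U := spectralmx P; pose d := spectral_diag P.
have uU : U \is unitarymx := spectral_unitarymx P.
have PE : P = U^t* *m diag_mx d *m U.
  by rewrite {1}(orthomx_spectralP nP) invmx_unitary.
have dr i : d 0 i \is Num.real.
  by have /mxOverP := hermitian_spectral_diag_real hs; exact.
have qE v : qform P v = qform (diag_mx d) (v *m U^t*).
  by rewrite qform_mul trmxCK -PE.
split=> [kN|[V hV]].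
  apply: (negsq_le kN).
  pose S : 'M[R[i]]_(#|N|, n) := \matrix_(i, j) (enum_val i == j)%:R.
  exists (S *m U) => x x0; rewrite qE mulmxA.
  rewrite -mulmxA (unitarymxP uU) mulmx1 qform_diag.
  have xS i : (x *m S) 0 (enum_val i) = x 0 i.
    rewrite mxE (bigD1 i)//= mxE eqxx mulr1 big1 ?addr0// => j ji.
    by rewrite mxE (inj_eq enum_val_inj) (negPf ji) mulr0.
  have xS0 j : j \notin N -> (x *m S) 0 j = 0.
    move=> jN; rewrite mxE big1// => i _; rewrite mxE.
    by case: eqP => [e|]; rewrite ?mulr0//; move: jN; rewrite -e enum_valP.
  have [j xj] : exists j, x 0 j != 0.
    apply/existsP; apply: contraNT x0 => /existsPn h.
    apply/eqP/rowP => j; rewrite mxE; have := h j.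
    by rewrite negbK => /eqP.
  have le0 i : d 0 i * `|(x *m S) 0 i| ^+ 2 <= 0.
    case: (boolP (i \in N)) => [|/xS0 ->]; last by rewrite normr0 expr0n mulr0.
    rewrite inE => di; rewrite mulr_le0_ge0 ?exprn_ge0// ltW//.
  rewrite (bigD1 (enum_val j))//= -[ltRHS]addr0 ltr_leD//.
    have := enum_valP j; rewrite inE => dj; rewrite -/d in dj.
    by rewrite pmulr_llt0 // xS exprn_gt0// normr_gt0.
  by rewrite sumr_le0.
rewrite leqNgt; apply/negP => Nk.
pose S : 'M[R[i]]_(n, #|N|) := \matrix_(i, j) (i == enum_val j)%:R.
have [x x0 xV] : exists2 x : 'rV_k, x != 0 & x *m (V *m U^t* *m S) = 0.
  have : (0 < \rank (kermx (V *m U^t* *m S)))%N.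
    by rewrite mxrank_ker subn_gt0 (leq_ltn_trans (rank_leq_col _)).
  rewrite lt0n mxrank_eq0 => /rowV0Pn[x /sub_kermxP xk x0]; by exists x.
have := hV x x0; rewrite qE qform_diag => hlt.
suff ge0 : 0 <= \sum_i d 0 i * `|(x *m V *m U^t*) 0 i| ^+ 2.
  by have := lt_geF hlt; rewrite ge0.
apply: sumr_ge0 => i _; case: (boolP (i \in N)) => iN.
  suff -> : (x *m V *m U^t*) 0 i = 0 by rewrite normr0 expr0n mulr0.
  have /rowP/(_ (enum_rank_in iN i)) := xV.
  rewrite !mulmxA mxE [RHS]mxE (bigD1 i)//= [S _ _]mxE enum_rankK_in// eqxx mulr1.
  rewrite big1 ?addr0// => j ji; by rewrite [S _ _]mxE enum_rankK_in// (negPf ji) mulr0.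
rewrite mulr_ge0 ?exprn_ge0//; move: iN; rewrite inE -real_leNgt ?real0//.
Qed.

Lemma qform_lin (C : numClosedFieldType) n (P : 'M[C]_n) (x v : 'rV[C]_n) :
  P^t* = P -> x *m P = 0 -> forall c, qform P (v + c *: x) = qform P v.
Proof.
move=> hP xP c; have Px : P *m x^t* = 0.
  by rewrite -hP -trCmx_mul xP trmx0 map_mx0.
rewrite /qform; congr (_ _ _).
by rewrite mulmxDl -scalemxAl xP scaler0 addr0 -mulmxA linearD linearZ /= map_mxD
  map_mxZ mulmxDr -scalemxAr Px scaler0 addr0 mulmxA.
Qed.

Lemma qform_col' (C : numClosedFieldType) n (P : 'M[C]_n.+1)
    (i : 'I_n.+1) (v : 'rV[C]_n.+1) :
  v 0 i = 0 -> qform P v = qform (row' i (col' i P)) (col' i v).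
Proof.
move=> vi; rewrite /qform !mxE (bigD1_ord i)//= !mxE vi rmorph0 mulr0 add0r.
apply: eq_bigr => j _; rewrite !mxE (bigD1_ord i)//= vi mul0r add0r.
by congr (_ * _); apply: eq_bigr => l _; rewrite !mxE.
Qed.

(** Adding multiples of a kernel vector [x] does not change the form. Each row of [V] is shifted
    along [x] until its coordinate [i] vanishes; that coordinate can then be dropped. *)
Lemma negsq_kernel (C : numClosedFieldType) n (P : 'M[C]_n.+1)
    (x : 'rV[C]_n.+1) (i : 'I_n.+1) k :
  P^t* = P -> x *m P = 0 -> x 0 i != 0 -> negsq P k ->
  negsq (row' i (col' i P)) k.
Proof.
move=> hP xP xi [V hV].
exists (col' i (V - (x 0 i)^-1 *: (col i V *m x))) => u u0.
set W := V - _.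
have -> : u *m col' i W = col' i (u *m W).
  by apply/rowP => j; rewrite !mxE; apply: eq_bigr => l _; rewrite !mxE.
have uW : u *m W = u *m V + (- (x 0 i)^-1 * (u *m V) 0 i) *: x.
  rewrite /W mulmxBr -scalemxAr mulmxA; congr (_ + _).
  rewrite mulNr scaleNr -scalerA; congr (- (_ *: _)).
  rewrite [u *m col i V]mx11_scalar mul_scalar_mx; congr (_ *: _).
  by rewrite !mxE; apply: eq_bigr => l _; rewrite !mxE.
rewrite -qform_col'; last first.
  by rewrite uW !mxE -mulrA [X in _ + X]mulrC -mulrA mulrN mulfV// mulrN1 subrr.
by rewrite uW qform_lin// hV.
Qed.

(** Completing the square in the first block of variables. *)
Lemma qform_block (C : numClosedFieldType) n m (A : 'M[C]_n) (B : 'M[C]_(n, m))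
    (D : 'M[C]_m) u v : A^t* = A -> A \in unitmx ->
  qform (block_mx A B (B^t* ) D) (row_mx u v) =
  qform A (u + v *m B^t* *m invmx A) + qform (D - B^t* *m invmx A *m B) v.
Proof.
move=> hA uA; have hA' : (invmx A)^t* = invmx A.
  by rewrite trmx_inv map_invmx hA.
rewrite /qform tr_row_mx map_col_mx mul_row_block mul_row_col.
have -> : (u + v *m B^t* *m invmx A)^t* = u^t* + invmx A *m B *m v^t*.
  rewrite linearD /= map_mxD !trCmx_mul hA' trmxCK mulmxA; congr (_ + _).
have addE (X Y : 'M[C]_1) : X 0 0 + Y 0 0 = (X + Y) 0 0 by rewrite mxE.
rewrite addE; congr (fun_of_matrix _ 0 0).
rewrite !mulmxDl !mulmxDr !mulmxDl !mulmxN !mulNmx !mulmxA.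
rewrite !mulmxKV// ?mulmxK//.
set a := u *m A *m _; set b := v *m B^t* *m u^t*; set c := u *m B *m _.
set d := v *m D *m _; set e := _ *m B *m v^t*.
by rewrite -[RHS]addrA (addrACA b) subrr addr0 addrACA.
Qed.

Lemma qformZ (C : numClosedFieldType) n (P : 'M[C]_n) c v :
  qform P (c *: v) = `|c| ^+ 2 * qform P v.
Proof.
rewrite /qform -scalemxAl linearZ /= map_mxZ -scalemxAr -scalemxAl.
by rewrite !mxE normCK mulrA [c^* * c]mulrC.
Qed.

(** The vector [v] is lifted so that its contribution to the first square of [qform_block] cancels;
    the form then splits into a part from [V] and a part from [v]. *)
Lemma negsq_block_add (C : numClosedFieldType) n m (A : 'M[C]_n)
    (B : 'M[C]_(n, m)) (D : 'M[C]_m) k v : A^t* = A -> A \in unitmx ->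
  negsq A k -> qform (D - B^t* *m invmx A *m B) v < 0 ->
  negsq (block_mx A B (B^t* ) D) (k + 1).
Proof.
move=> hA uA [V hV] Sv.
exists (block_mx V 0 (- (v *m B^t* *m invmx A)) v) => x x0.
rewrite -[x]hsubmxK mul_row_block qform_block// mulmx0 add0r.
set x1 := lsubmx x; set t := rsubmx x; rewrite [t]mx11_scalar !mul_scalar_mx.
rewrite scalerN -!scalemxAl subrK qformZ.
have [x10|x10] := eqVneq x1 0; last first.
  rewrite -[ltRHS]addr0 ltr_leD ?hV//.
  by rewrite mulr_ge0_le0 ?exprn_ge0// ltW.
rewrite x10 mul0mx {1}/qform !mul0mx mxE add0r pmulr_rlt0//.
rewrite exprn_gt0// normr_gt0; apply: contraNneq x0 => t0.
rewrite -[x]hsubmxK -/x1 -/t x10 [t]mx11_scalar t0.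
by rewrite -scalemx1 scale0r row_mx0.
Qed.

(** Keeping only the first square of [qform_block] discards a nonnegative term, so a negative
    subspace is mapped to a negative subspace of [A]. *)
Lemma negsq_block_psd (C : numClosedFieldType) n m (A : 'M[C]_n)
    (B : 'M[C]_(n, m)) (D : 'M[C]_m) k : A^t* = A -> A \in unitmx ->
  psd (D - B^t* *m invmx A *m B) -> negsq (block_mx A B (B^t* ) D) k -> negsq A k.
Proof.
move=> hA uA pS [V]; rewrite -[V]hsubmxK => hV.
exists (lsubmx V + rsubmx V *m B^t* *m invmx A) => x /hV.
rewrite mul_mx_row qform_block// mulmxDr !mulmxA.
by apply: le_lt_trans; rewrite lerDl.
Qed.

Lemma psd_schur (C : numClosedFieldType) n m (A : 'M[C]_n)
    (B : 'M[C]_(n, m)) (D : 'M[C]_m) : A^t* = A -> A \in unitmx ->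
  psd (block_mx A B (B^t* ) D) -> psd (D - B^t* *m invmx A *m B).
Proof.
move=> hA uA pM v; have := pM (row_mx (- (v *m B^t* *m invmx A)) v).
by rewrite qform_block// addNr {1}/qform !mul0mx mxE add0r.
Qed.

Lemma psd_block (C : numClosedFieldType) n m (A : 'M[C]_n)
    (B : 'M[C]_(n, m)) (D : 'M[C]_m) : A^t* = A -> A \in unitmx -> psd A ->
  psd (D - B^t* *m invmx A *m B) -> psd (block_mx A B (B^t* ) D).
Proof.
by move=> hA uA pA pS v; rewrite -[v]hsubmxK qform_block// addr_ge0.
Qed.

(** * Pick kernels and their Schur complements *)

Definition pickK (C : numClosedFieldType) (f : C -> C) (z w : C) : C :=
  (1 - f z * (f w)^*) / (1 - z * w^*).

Definition kernel_mx (C : numClosedFieldType) (K : C -> C -> C) n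
  (z : n.-tuple C) : 'M[C]_n := \matrix_(i, j) K (tnth z i) (tnth z j).

Lemma pickK_conj (C : numClosedFieldType) (f : C -> C) z w :
  (pickK f z w)^* = pickK f w z.
Proof.
by rewrite /pickK rmorphM fmorphV !rmorphB !rmorphM /= !conjCK rmorph1
  [(f z)^* * _]mulrC [z^* * _]mulrC.
Qed.

Lemma kernel_mx_herm (C : numClosedFieldType) (K : C -> C -> C) n
  (z : n.-tuple C) : (forall x y, (K x y)^* = K y x) ->
  (kernel_mx K z)^t* = kernel_mx K z.
Proof. by move=> hK; apply/matrixP => i j; rewrite !mxE hK. Qed.

Lemma pick_mxE (R : realType) (f : R[i] -> R[i]) n (z : n.-tuple R[i]) :
  pick_mx f z = kernel_mx (pickK f) z.
Proof. by []. Qed.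

Lemma pick_herm (R : realType) (f : R[i] -> R[i]) n (z : n.-tuple R[i]) :
  (pick_mx f z)^t* = pick_mx f z.
Proof. by rewrite pick_mxE; apply: kernel_mx_herm; apply: pickK_conj. Qed.

(** [S] selects for each entry of [z] a position in [y]; repetitions in either tuple are
    harmless. *)
Lemma kernel_mx_subset (C : numClosedFieldType) (K : C -> C -> C) m n
    (z : m.-tuple C) (y : n.-tuple C) : {subset z <= y} ->
  exists S : 'M[C]_(m, n), S *m kernel_mx K y *m S^t* = kernel_mx K z.
Proof.
move=> zy; have /choice[s hs] (i : 'I_m) : exists j, tnth z i = tnth y j.
  by apply/tnthP/zy/mem_tnth.
exists (rowsub s 1%:M).
rewrite mul_rowsub_mx mul1mx; apply/matrixP => i j; rewrite !mxE (bigD1 (s j))//=.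
rewrite !mxE eqxx rmorph1 mulr1 -!hs big1 ?addr0// => l lj.
by rewrite !mxE eq_sym (negPf lj) rmorph0 mulr0.
Qed.

Lemma negsq_subset (C : numClosedFieldType) (K : C -> C -> C) m n
    (z : m.-tuple C) (y : n.-tuple C) k : {subset z <= y} ->
  negsq (kernel_mx K z) k -> negsq (kernel_mx K y) k.
Proof.
move=> /(kernel_mx_subset K)[S hS] [V hV].
by exists (V *m S) => x x0; rewrite mulmxA qform_mul hS hV.
Qed.

Lemma psd_subset (C : numClosedFieldType) (K : C -> C -> C) m n
    (z : m.-tuple C) (y : n.-tuple C) : {subset z <= y} ->
  psd (kernel_mx K y) -> psd (kernel_mx K z).
Proof.
by move=> /(kernel_mx_subset K)[S hS] hy v; rewrite -hS -qform_mul.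
Qed.

(* A kernel vector of the matrix makes one of its points redundant. *)
Lemma negsq_unit_subtuple (C : numClosedFieldType) (K : C -> C -> C) n
    (z : n.-tuple C) k : (forall x y, (K x y)^* = K y x) -> uniq z ->
  negsq (kernel_mx K z) k ->
  exists m (y : m.-tuple C), [/\ (m <= n)%N, uniq y, {subset y <= z},
    negsq (kernel_mx K y) k & kernel_mx K y \in unitmx].
Proof.
move=> hK; elim: n z => [|n IH] z uz hz.
  by exists 0%N, z; split=> //; rewrite unitmxE det_mx00 unitr1.
have [uP|nP] := boolP (kernel_mx K z \in unitmx); first by exists n.+1, z; split.
have /rowV0Pn[x /sub_kermxP xk x0] : kermx (kernel_mx K z) != 0.
  by rewrite kermx_eq0 row_free_unit.
have [i xi] : exists i, x 0 i != 0.
  apply/existsP; apply: contraNT x0 => /existsPn h.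
  by apply/eqP/rowP => j; rewrite mxE; have := h j; rewrite negbK => /eqP.
have hz' := negsq_kernel (kernel_mx_herm z hK) xk xi hz.
pose y := [tuple tnth z (lift i j) | j < n].
have yz : {subset y <= z}.
  by move=> c /mapP[j _ ->]; apply: mem_tnth.
have uy : uniq y.
  rewrite map_inj_uniq ?enum_uniq// => j l /(tuple_uniqP _ uz).
  exact: lift_inj.
have {}hz' : negsq (kernel_mx K y) k.
  suff <- : row' i (col' i (kernel_mx K z)) = kernel_mx K y by [].
  by apply/matrixP => j l; rewrite !mxE !tnth_mktuple.
have [m [y' [mn uy' y'y h1 h2]]] := IH y uy hz'.
exists m, y'; split => //; first exact: leqW.
by move=> c /y'y/yz.
Qed.

Definition pick_row (C : numClosedFieldType) (f : C -> C) n (z : n.-tuple C)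
  (y : C) : 'rV[C]_n := \row_j pickK f y (tnth z j).

Definition pickS (C : numClosedFieldType) (f : C -> C) n (z : n.-tuple C)
  (y w : C) : C := pickK f y w -
  (pick_row f z y *m invmx (kernel_mx (pickK f) z) *m (pick_row f z w)^t*) 0 0.

Definition pick_cross (C : numClosedFieldType) (f : C -> C) n m (z : n.-tuple C)
  (y : m.-tuple C) : 'M[C]_(n, m) := \matrix_(i, j) pickK f (tnth z i) (tnth y j).

Lemma pick_cat (C : numClosedFieldType) (f : C -> C) n m (z : n.-tuple C)
    (y : m.-tuple C) :
  kernel_mx (pickK f) [tuple of z ++ y] =
  block_mx (kernel_mx (pickK f) z) (pick_cross f z y) ((pick_cross f z y)^t*)
    (kernel_mx (pickK f) y).
Proof.
apply/matrixP => i j; rewrite [LHS]mxE.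
case: (split_ordP i) => i' ->; case: (split_ordP j) => j' ->;
  rewrite ?(tnth_lshift, tnth_rshift).
- by rewrite block_mxEul mxE.
- by rewrite block_mxEur mxE.
- by rewrite block_mxEdl !mxE pickK_conj.
- by rewrite block_mxEdr mxE.
Qed.

Lemma pick_schurE (C : numClosedFieldType) (f : C -> C) n m (z : n.-tuple C)
    (y : m.-tuple C) :
  kernel_mx (pickK f) y - (pick_cross f z y)^t* *m
    invmx (kernel_mx (pickK f) z) *m pick_cross f z y = kernel_mx (pickS f z) y.
Proof.
apply/matrixP => i j; rewrite !mxE /pickS; congr (_ - _).
rewrite mxE; apply: eq_bigr => l _; congr (_ * _); last by rewrite !mxE pickK_conj.
by rewrite !mxE; apply: eq_bigr => l' _; rewrite !mxE pickK_conj.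
Qed.

Lemma pickS_conj (C : numClosedFieldType) (f : C -> C) n (z : n.-tuple C) x y :
  (pickS f z x y)^* = pickS f z y x.
Proof.
rewrite /pickS rmorphB /= pickK_conj; congr (_ - _).
set P := kernel_mx _ _; set X := _ *m _ *m _.
transitivity (X^t* 0 0); first by rewrite !mxE.
have hP : P^t* = P by apply: kernel_mx_herm; apply: pickK_conj.
by rewrite /X !trCmx_mul trmxCK mulmxA trmx_inv map_invmx hP.
Qed.

(* Here [zb], [Fb], [wb], [fb] stand for the conjugates; [k] and [l] are the rows
   K(y,Z) P^-1 (1 - T)^-1 and conj(K(w,Z) P^-1 (1 - T)^-1) with T = diag(z). *)
Lemma J_identity (C : comNzRingType) n (k l z zb F Fb : 'I_n -> C)
    (P : 'I_n -> 'I_n -> C) (y f wb fb : C) :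
  (forall j, \sum_i k i * (1 - z i) * P i j * (1 - y * zb j) = 1 - f * Fb j) ->
  (forall i, \sum_j l j * (1 - zb j) * P i j * (1 - wb * z i) = 1 - fb * F i) ->
  (forall i j, P i j * (1 - z i * zb j) = 1 - F i * Fb j) ->
  (1 - (1 - y) * \sum_i k i) * (1 - (1 - wb) * \sum_j l j) -
  (f - (1 - y) * \sum_i k i * F i) * (fb - (1 - wb) * \sum_j l j * Fb j) =
  1 - f * fb -
  (1 - y * wb) * \sum_i \sum_j k i * (1 - z i) * P i j * (1 - zb j) * l j.
Proof.
move=> h1 h2 h3.
set S1 := \sum_i k i; set S2 := \sum_i k i * F i.
set S3 := \sum_j l j; set S4 := \sum_j l j * Fb j; set Phi := \sum_i \sum_j _.
have e1 : S1 - fb * S2 =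
    \sum_i \sum_j k i * l j * P i j * ((1 - zb j) * (1 - wb * z i)).
  rewrite mulr_sumr -sumrB; apply: eq_bigr => i _.
  transitivity (k i * (1 - fb * F i)); first by ring.
  by rewrite -h2 mulr_sumr; apply: eq_bigr => j _; ring.
have e2 : S3 - f * S4 =
    \sum_i \sum_j k i * l j * P i j * ((1 - z i) * (1 - y * zb j)).
  rewrite exchange_big mulr_sumr -sumrB; apply: eq_bigr => j _.
  transitivity (l j * (1 - f * Fb j)); first by ring.
  by rewrite -h1 mulr_sumr; apply: eq_bigr => i _; ring.
have e3 : S1 * S3 - S2 * S4 =
    \sum_i \sum_j k i * l j * P i j * (1 - z i * zb j).
  rewrite !mulr_suml -sumrB; apply: eq_bigr => i _.
  rewrite !mulr_sumr -sumrB; apply: eq_bigr => j _.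
  by rewrite -[RHS]mulrA h3; ring.
(* Termwise this is (1 - y)(1 - zb)(1 - wb z) + (1 - wb)(1 - z)(1 - y zb) - (1 - y)(1 - wb)(1 - z
   zb) = (1 - y wb)(1 - z)(1 - zb). *)
have e4 : (1 - y) * (S1 - fb * S2) + (1 - wb) * (S3 - f * S4) -
    (1 - y) * (1 - wb) * (S1 * S3 - S2 * S4) = (1 - y * wb) * Phi.
  rewrite e1 e2 e3 !mulr_sumr -big_split -sumrB; apply: eq_bigr => i _ /=.
  rewrite !mulr_sumr -big_split -sumrB; apply: eq_bigr => j _ /=; ring.
by rewrite -e4; ring.
Qed.

Lemma disk_neq0 (C : numClosedFieldType) (y w : C) : `|y| < 1 -> `|w| < 1 ->
  1 - y * w^* != 0.
Proof.
move=> hy hw; rewrite subr_eq0; apply/eqP => /(congr1 Num.norm) /eqP.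
rewrite normr1 normrM norm_conjC eq_sym lt_eqF// mulr_ilt1//.
Qed.

(** * Linear fractional form of the Schur complement *)

Section Jstructure.
Variables (C : numClosedFieldType) (f : C -> C) (n : nat) (z : n.-tuple C).
Let P := kernel_mx (pickK f) z.
Hypotheses (zD : forall i, `|tnth z i| < 1) (uP : P \in unitmx).

(** The transform is normalized at the boundary point 1: [J_a] and [J_b] are affine in [f y], and
    the factor 1 - y reduces them to 1 and [f y] there. Since 1 lies outside the open disk, every 1
    - z_i is invertible. *)
Definition J_alpha : 'cV[C]_n :=
  invmx (kernel_mx (pickK f) z) *m \col_i (1 - tnth z i)^-1.
Definition J_beta : 'cV[C]_n :=
  invmx (kernel_mx (pickK f) z) *m \col_i (f (tnth z i) / (1 - tnth z i)).
Definition J_a y := 1 - (1 - y) * \sum_j pickK f y (tnth z j) * J_alpha j 0.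
Definition J_b y := f y - (1 - y) * \sum_j pickK f y (tnth z j) * J_beta j 0.

Let kr y := pick_row f z y *m invmx P.
Let kp y i := kr y 0 i / (1 - tnth z i).

Let z1 i : 1 - tnth z i != 0.
Proof.
by rewrite subr_eq0; apply: contraTneq (zD i) => <-; rewrite normr1 ltxx.
Qed.

Let J_aE y : J_a y = 1 - (1 - y) * \sum_i kp y i.
Proof.
congr (_ - _ * _).
transitivity ((pick_row f z y *m J_alpha) 0 0).
  by rewrite mxE; apply: eq_bigr => j _; rewrite !mxE.
rewrite /J_alpha mulmxA -/P -/(kr y) mxE; apply: eq_bigr => j _.
by rewrite [(\col_i _) _ _]mxE.
Qed.

Let J_bE y : J_b y = f y - (1 - y) * \sum_i kp y i * f (tnth z i).
Proof.
congr (_ - _ * _).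
transitivity ((pick_row f z y *m J_beta) 0 0).
  by rewrite mxE; apply: eq_bigr => j _; rewrite !mxE.
rewrite /J_beta mulmxA -/P -/(kr y) mxE; apply: eq_bigr => j _.
by rewrite [(\col_i _) _ _]mxE /kp mulrAC mulrA.
Qed.

Let h1 y j : `|y| < 1 -> \sum_i kp y i * (1 - tnth z i) *
  pickK f (tnth z i) (tnth z j) * (1 - y * (tnth z j)^*) =
  1 - f y * (f (tnth z j))^*.
Proof.
move=> hy; rewrite -mulr_suml.
have -> : \sum_i kp y i * (1 - tnth z i) * pickK f (tnth z i) (tnth z j) =
    (kr y *m P) 0 j.
  by rewrite mxE; apply: eq_bigr => i _; rewrite [P _ _]mxE /kp divfK.
by rewrite /kr mulmxKV// mxE /pickK divfK// disk_neq0.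
Qed.

Let h3 i j : pickK f (tnth z i) (tnth z j) * (1 - tnth z i * (tnth z j)^*) =
  1 - f (tnth z i) * (f (tnth z j))^*.
Proof. by rewrite /pickK divfK// disk_neq0. Qed.

(** An instance of [J_identity] whose double sum is the correction term of the Schur complement.
    Dividing by [J_a y] and the conjugate of [J_a w] produces the numerator of the Pick kernel of
    [J_b / J_a]. *)
Lemma pickS_J y w : `|y| < 1 -> `|w| < 1 ->
  pickS f z y w * (1 - y * w^*) = J_a y * (J_a w)^* - J_b y * (J_b w)^*.
Proof.
move=> hy hw.
rewrite !J_aE !J_bE !rmorphB !rmorphM !rmorphB !rmorph1 !rmorph_sum /=.
have -> : \sum_i (kp w i * f (tnth z i))^* =
    \sum_i (kp w i)^* * (f (tnth z i))^*.
  by apply: eq_bigr => i _; rewrite rmorphM.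
rewrite (@J_identity _ _ _ _ (tnth z) (fun j => (tnth z j)^*) _ _
  (fun i j => pickK f (tnth z i) (tnth z j))) //; last 2 first.
- by move=> j; apply: h1.
- move=> i; rewrite -[RHS]conjCK rmorphB rmorphM rmorph1 /= conjCK -h1// rmorph_sum.
  apply: eq_bigr => j _.
  rewrite -(pickK_conj f (tnth z j)).
  move: (pickK f _ _) (kp w j) => p q.
  by rewrite !rmorphM !rmorphB !rmorphM !rmorph1 /= conjCK; ring.
rewrite /pickS mulrBl {1}/pickK divfK ?disk_neq0//; congr (_ - _).
rewrite mulrC -/P -[_ *m invmx P]/(kr y); congr (_ * _).
have -> : (pick_row f z w)^t* = P *m (kr w)^t*.
  have hP : P^t* = P by apply: kernel_mx_herm; apply: pickK_conj.
  by rewrite -{1}hP -trCmx_mul /kr mulmxKV.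
rewrite mulmxA mxE exchange_big /=; apply: eq_bigr => j _.
have -> : (kr w)^t* j 0 = (kr w 0 j)^* by rewrite 2!mxE.
rewrite [(kr y *m P) 0 j]mxE mulr_suml; apply: eq_bigr => i _.
have kE x l : kr x 0 l = kp x l * (1 - tnth z l) by rewrite /kp divfK.
rewrite [P _ _]mxE !kE; move: (pickK f _ _) (kp w j) (kp y i) => p q r.
by rewrite rmorphM rmorphB rmorph1 /=; ring.
Qed.

(** Recovers the coefficients [kp] from [J_a] and [J_b]. The two rows are compared after right
    multiplication by [P], where [h1] and [h3] apply entrywise. *)
Let J_row y : `|y| < 1 -> forall j,
  J_a y * (J_alpha j 0)^* - J_b y * (J_beta j 0)^* = kp y j * (y - tnth z j).
Proof.
move=> hy.
suff e : J_a y *: J_alpha^t* - J_b y *: J_beta^t* =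
    \row_j (kp y j * (y - tnth z j)).
  by move=> j; have /rowP/(_ j) := e; rewrite !mxE.
have hP : P^t* = P by apply: kernel_mx_herm; apply: pickK_conj.
have hP' : (invmx P)^t* = invmx P by rewrite trmx_inv map_invmx hP.
apply: (can_inj (mulmxK uP)); rewrite mulmxBl -!scalemxAl.
rewrite /J_alpha /J_beta !trCmx_mul -/P hP' !mulmxKV//.
apply/rowP => l; rewrite !mxE.
apply: (mulIf (x := (1 - tnth z l)^*)); first by rewrite conjC_eq0.
rewrite mulr_suml !rmorphM !fmorphV /= mulrBl -!mulrA.
rewrite mulVf ?conjC_eq0// mulr1 (mulrC (J_b y)).
transitivity (1 - f y * (f (tnth z l))^* - (1 - y) *
   \sum_i kp y i * (1 - f (tnth z i) * (f (tnth z l))^*)).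
  rewrite J_aE J_bE mulr1.
  have -> : \sum_i kp y i * (1 - f (tnth z i) * (f (tnth z l))^*) =
    \sum_i kp y i - (\sum_i kp y i * f (tnth z i)) * (f (tnth z l))^*.
    by rewrite mulr_suml -sumrB; apply: eq_bigr => i _; ring.
  ring.
rewrite -(h1 l hy) mulr_sumr -sumrB; apply: eq_bigr => i _.
by rewrite -h3 !mxE rmorphB rmorph1 /=; ring.
Qed.

(** With [J_inv2], this inverts the transform off [z]. It shows that [J_a] and [J_b] have no common
    zero there, and it expresses [f] through their quotient. *)
Lemma J_inv1 y : `|y| < 1 -> y \notin z ->
  1 = J_a y + (1 - y) * \sum_j
     (J_a y * (J_alpha j 0)^* - J_b y * (J_beta j 0)^*) / (y - tnth z j).
Proof.
move=> hy yz; rewrite [X in _ * X](_ : _ = \sum_i kp y i); last first.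
  apply: eq_bigr => j _; rewrite J_row// mulfK//.
  by rewrite subr_eq0; apply: contraNneq yz => ->; apply: mem_tnth.
by rewrite J_aE subrK.
Qed.

Lemma J_inv2 y : `|y| < 1 -> y \notin z ->
  f y = J_b y + (1 - y) * \sum_j
     (J_a y * (J_alpha j 0)^* - J_b y * (J_beta j 0)^*) / (y - tnth z j)
       * f (tnth z j).
Proof.
move=> hy yz; rewrite [X in _ * X](_ : _ = \sum_i kp y i * f (tnth z i)).
  by rewrite J_bE subrK.
apply: eq_bigr => j _; rewrite J_row// mulfK//.
by rewrite subr_eq0; apply: contraNneq yz => ->; apply: mem_tnth.
Qed.

End Jstructure.

(** * Complex functions with Lipschitz difference quotients *)

(** The norm of [R[i]] is itself [R[i]]-valued; a real-valued one gives access to a total order and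
    to real arithmetic. *)
Definition cnorm (R : realType) (z : R[i]) : R := complex.Re `|z|.

Section Cnorm.
Variable R : realType.
Implicit Types z w : R[i].
Local Notation N := (@cnorm R).

Lemma cnormE z : `|z| = (N z)%:C%C.
Proof. by rewrite /cnorm RRe_real// normr_real. Qed.

Let inj : injective (real_complex R) := @complexI R.

Lemma cnorm_ge0 z : 0 <= N z.
Proof. by rewrite -lecR -cnormE; apply: normr_ge0. Qed.

Lemma cnormM z w : N (z * w) = N z * N w.
Proof. by apply: inj; rewrite rmorphM /= -!cnormE normrM. Qed.

Lemma cnormD z w : N (z + w) <= N z + N w.
Proof. by rewrite -lecR rmorphD /= -!cnormE ler_normD. Qed.

Lemma cnormN z : N (- z) = N z.
Proof. by rewrite /cnorm normrN. Qed.

Lemma cnormB z w : N (z - w) <= N z + N w.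
Proof. by rewrite -(cnormN w) cnormD. Qed.

Lemma cnorm_sub_ge z w : N z - N w <= N (z - w).
Proof. by rewrite lerBlDr; have := cnormD (z - w) w; rewrite subrK. Qed.

Lemma cnorm_distC z w : N (z - w) = N (w - z).
Proof. by rewrite -cnormN opprB. Qed.

Lemma cnorm_dist_triangle x z w : N (z - w) <= N (z - x) + N (x - w).
Proof. by rewrite (_ : z - w = (z - x) + (x - w)) ?cnormD//; ring. Qed.

Lemma cnorm_Cconj z : N (Num.conj z) = N z.
Proof. by rewrite /cnorm norm_conjC. Qed.

Lemma cnormV z : N z^-1 = (N z)^-1.
Proof. by apply: inj; rewrite fmorphV /= -!cnormE normfV. Qed.

Lemma cnorm0 : N 0 = 0.
Proof. by rewrite /cnorm normr0. Qed.

Lemma cnorm1 : N 1 = 1.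
Proof. by rewrite /cnorm normr1. Qed.

Lemma cnorm_eq0 z : (N z == 0) = (z == 0).
Proof. by rewrite -(inj_eq inj) -cnormE normr_eq0. Qed.

Lemma cnorm_gt0 z : (0 < N z) = (z != 0).
Proof. by rewrite lt_def cnorm_eq0 cnorm_ge0 andbT. Qed.

Lemma cnorm_real (r : R) : N r%:C%C = `|r|.
Proof. by apply: inj; rewrite -cnormE normc_def /= expr0n addr0 sqrtr_sqr. Qed.

Lemma cnormX z n : N (z ^+ n) = N z ^+ n.
Proof. by apply: inj; rewrite rmorphXn /= -!cnormE normrX. Qed.

Lemma cnorm_nat n : N n%:R = n%:R.
Proof. by apply: inj; rewrite -cnormE rmorph_nat normr_nat. Qed.

Lemma cnorm_sum (I : Type) (s : seq I) (P : pred I) (F : I -> R[i]) :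
  N (\sum_(i <- s | P i) F i) <= \sum_(i <- s | P i) N (F i).
Proof.
elim/big_ind2: _ => [|x1 x2 y1 y2 h1 h2|//]; first by rewrite cnorm0.
by rewrite (le_trans (cnormD _ _))// lerD.
Qed.

Lemma mulr_cconj z : z * Num.conj z = (N z ^+ 2)%:C%C.
Proof. by rewrite -normCK cnormE rmorphXn. Qed.

Lemma diskE z : (`|z| < 1) = (N z < 1).
Proof. by rewrite cnormE -[1]/(1%:C%C) ltcR. Qed.

End Cnorm.

(* [f] is Lipschitz near [z] and so are its difference quotients: a complex
   C^{1,1} condition that mentions no derivative. *)
Definition C11 (R : realType) (f : R[i] -> R[i]) (z : R[i]) : Prop :=
  exists r M : R, [/\ 0 < r, 0 <= M & forall x y w : R[i],
    cnorm (x - z) < r -> cnorm (y - z) < r -> cnorm (w - z) < r ->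
    [/\ cnorm (f x) <= M, cnorm (f y - f x) <= M * cnorm (y - x) &
      cnorm ((f y - f x) * (w - x) - (f w - f x) * (y - x)) <=
      M * (cnorm (y - w) * cnorm (y - x) * cnorm (w - x))]].

(** A condition at the single point [z], weaker than being Lipschitz near [z]. Two-point positivity
    yields it where [C11] is not known. *)
Definition Lip (R : realType) (f : R[i] -> R[i]) (z : R[i]) : Prop :=
  exists r M : R, [/\ 0 < r, 0 <= M & forall x : R[i],
    cnorm (x - z) < r -> cnorm (f x - f z) <= M * cnorm (x - z)].

Section C11.
Variable R : realType.
Implicit Types (f g : R[i] -> R[i]) (z : R[i]).
Local Notation N := (@cnorm R).

Lemma C11_Lip f z : C11 f z -> Lip f z.
Proof.
move=> [r [M [r0 M0 h]]]; exists r, M; split => // x xz.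
by have [] := h z x x; rewrite ?subrr ?cnorm0.
Qed.

Lemma C11_ext f g z e : 0 < e -> (forall x, N (x - z) < e -> f x = g x) ->
  C11 f z -> C11 g z.
Proof.
move=> e0 fg [r [M [r0 M0 h]]]; exists (Num.min r e), M; split=> //.
  by rewrite lt_min r0.
move=> x y w; rewrite !lt_min => /andP[xr xe] /andP[yr ye] /andP[wr we].
by rewrite -!fg//; apply: h.
Qed.

Lemma C11_cst c z : C11 (fun=> c) z.
Proof.
exists 1, (N c); split=> [//||x y w _ _ _]; first exact: cnorm_ge0.
rewrite !subrr !mul0r subrr cnorm0; split=> //;
  by rewrite !mulr_ge0 ?cnorm_ge0.
Qed.

Lemma C11_id z : C11 (fun x => x) z.
Proof.
exists 1, (N z + 1); split=> [//||x y w xz _ _].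
  by rewrite addr_ge0// cnorm_ge0.
split.
- by have := cnorm_sub_ge x z; lra.
- by rewrite ler_peMl ?cnorm_ge0// lerDr cnorm_ge0.
- rewrite [_ * (y - x)]mulrC subrr cnorm0 !mulr_ge0 ?cnorm_ge0//.
  by rewrite addr_ge0// cnorm_ge0.
Qed.

Lemma C11D f g z : C11 f z -> C11 g z -> C11 (fun x => f x + g x) z.
Proof.
move=> [r [M [r0 M0 h]]] [s [L [s0 L0 k]]].
exists (Num.min r s), (M + L); split; rewrite ?lt_min ?r0 ?addr_ge0//.
move=> x y w; rewrite !lt_min => /andP[xr xs] /andP[yr ys] /andP[wr ws].
have [h1 h2 h3] := h x y w xr yr wr; have [k1 k2 k3] := k x y w xs ys ws.
split; rewrite ?mulrDl.
- by rewrite (le_trans (cnormD _ _))// lerD.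
- by rewrite opprD addrACA (le_trans (cnormD _ _))// lerD.
- apply: le_trans (lerD h3 k3); apply: le_trans (cnormD _ _).
  by rewrite le_eqVlt; apply/orP; left; apply/eqP; congr N; ring.
Qed.

Lemma C11M f g z : C11 f z -> C11 g z -> C11 (fun x => f x * g x) z.
Proof.
move=> [r [M [r0 M0 h]]] [s [L [s0 L0 k]]].
exists (Num.min r s), (3 * (M * L)); split; rewrite ?lt_min ?r0 ?mulr_ge0//.
move=> x y w; rewrite !lt_min => /andP[xr xs] /andP[yr ys] /andP[wr ws].
have [h1 h2 h3] := h x y w xr yr wr; have [k1 k2 k3] := k x y w xs ys ws.
have [hy1 _ _] := h y x w yr xr wr; have [ky1 _ _] := k y x w ys xs ws.
have [_ hw2 _] := h x w w xr wr wr; have [_ kw2 _] := k w y w ws ys ws.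
have ML : 0 <= M * L by rewrite mulr_ge0.
have dyx := cnorm_ge0 (y - x); have dwx := cnorm_ge0 (w - x).
have dyw := cnorm_ge0 (y - w).
split.
- rewrite cnormM; have : N (f x) * N (g x) <= M * L by apply: ler_pM; rewrite ?cnorm_ge0.
  lra.
- have -> : f y * g y - f x * g x = (f y - f x) * g y + f x * (g y - g x) by ring.
  have e1 : N ((f y - f x) * g y) <= M * N (y - x) * L.
    by rewrite cnormM ler_pM ?cnorm_ge0.
  have e2 : N (f x * (g y - g x)) <= M * (L * N (y - x)).
    by rewrite cnormM ler_pM ?cnorm_ge0.
  have := cnormD ((f y - f x) * g y) (f x * (g y - g x)).
  have : 0 <= M * L * N (y - x) by rewrite mulr_ge0.
  move: e1 e2; lra.
(* Leibniz rule for second differences. Each of the three resulting terms is at most M L D, whence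
   the constant 3. *)
- have -> : (f y * g y - f x * g x) * (w - x) - (f w * g w - f x * g x) * (y - x)
    = f x * ((g y - g x) * (w - x) - (g w - g x) * (y - x)) +
      (g y * ((f y - f x) * (w - x) - (f w - f x) * (y - x)) +
       (f w - f x) * (y - x) * (g y - g w)) by ring.
  apply: le_trans (cnormD _ _) _; apply: le_trans (lerD (lexx _) (cnormD _ _)) _.
  set D := N (y - w) * N (y - x) * N (w - x) in h3 k3 *.
  have e1 : N (f x * ((g y - g x) * (w - x) - (g w - g x) * (y - x))) <= M * (L * D).
    by rewrite cnormM ler_pM ?cnorm_ge0.
  have e2 : N (g y * ((f y - f x) * (w - x) - (f w - f x) * (y - x))) <= L * (M * D).
    by rewrite cnormM ler_pM ?cnorm_ge0.
  have e3 : N ((f w - f x) * (y - x) * (g y - g w)) <=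
     M * N (w - x) * N (y - x) * (L * N (y - w)).
    by rewrite !cnormM ler_pM ?mulr_ge0 ?cnorm_ge0// ler_pM ?cnorm_ge0.
  have -> : 3 * (M * L) * D = M * (L * D) + (L * (M * D) +
     M * N (w - x) * N (y - x) * (L * N (y - w))) by rewrite /D; ring.
  by apply: lerD => //; apply: lerD.
Qed.

Lemma C11N f z : C11 f z -> C11 (fun x => - f x) z.
Proof.
move=> h; apply: (@C11_ext (fun x => (-1) * f x) _ _ 1) => // [x _|].
  by rewrite mulN1r.
by apply: C11M => //; apply: C11_cst.
Qed.

Lemma C11B f g z : C11 f z -> C11 g z -> C11 (fun x => f x - g x) z.
Proof. by move=> hf hg; apply: C11D => //; apply: C11N. Qed.

Lemma C11V f z : C11 f z -> f z != 0 -> C11 (fun x => (f x)^-1) z.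
Proof.
move=> [r [M [r0 M0 h]]] fz.
have [c c0 cE] : exists2 c, 0 < c & N (f z) = 2 * c.
  by exists (N (f z) / 2); [rewrite divr_gt0// cnorm_gt0|field].
(* Within this radius [f] moves by at most c = |f z| / 2, so its modulus stays at least c. *)
pose s := Num.min r (c / (M + 1)).
have M1 : 0 < M + 1 by rewrite ltr_wpDl.
have s0 : 0 < s by rewrite lt_min r0 divr_gt0.
have fc x : N (x - z) < s -> c <= N (f x).
  rewrite lt_min => /andP[xr xc].
  have h2 : N (f x - f z) <= M * N (x - z).
    by have [] := h z x x; rewrite ?subrr ?cnorm0.
  have : M * N (x - z) <= c.
    move: xc; rewrite ltr_pdivlMr// => xc.
    have := cnorm_ge0 (x - z); move: xc; nra.
  have := cnorm_sub_ge (f z) (f x); rewrite cnorm_distC.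
  lra.
have cge0 : 0 <= c := ltW c0.
have t1 : 0 <= c^-1 by rewrite invr_ge0.
have t2 : 0 <= M / c ^+ 2 by rewrite mulr_ge0 ?invr_ge0 ?exprn_ge0.
have t3 : 0 <= 2 * M ^+ 2 / c ^+ 3 by rewrite !mulr_ge0 ?invr_ge0 ?exprn_ge0.
exists s, (c^-1 + M / c ^+ 2 + 2 * M ^+ 2 / c ^+ 3); split=> //.
  exact: addr_ge0 (addr_ge0 t1 t2) t3.
move=> x y w xs ys ws.
have [xr yr wr] : [/\ N (x - z) < r, N (y - z) < r & N (w - z) < r].
  by move: xs ys ws; rewrite !lt_min => /andP[? _] /andP[? _] /andP[? _].
have [h1 h2 h3] := h x y w xr yr wr.
have [hw1 _ _] := h w x x wr xr xr; have [_ hw2 _] := h x w w xr wr wr.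
have [_ hyw _] := h w y y wr yr yr.
have [[fx fy] fw] := (fc _ xs, fc _ ys, fc _ ws).
have nz u : c <= N u -> u != 0 by move=> cu; rewrite -cnorm_gt0 (lt_le_trans c0).
have [[fx0 fy0] fw0] := (nz _ fx, nz _ fy, nz _ fw).
split.
- rewrite cnormV; have : (N (f x))^-1 <= c^-1 by rewrite lef_pV2 ?posrE ?(lt_le_trans c0).
  lra.
- have -> : (f y)^-1 - (f x)^-1 = - (f y - f x) / (f x * f y) by field; rewrite ?fx0 ?fy0.
  rewrite cnormM cnormV cnormN cnormM.
  apply: le_trans (_ : M / c ^+ 2 * N (y - x) <= _); last first.
    by rewrite ler_wpM2r ?cnorm_ge0//; lra.
  rewrite mulrAC ler_pM ?cnorm_ge0 ?invr_ge0 ?mulr_ge0 ?cnorm_ge0//.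
  rewrite lef_pV2 ?posrE ?mulr_gt0 ?cnorm_gt0 ?exprn_gt0//.
  by rewrite expr2 ler_pM// ltW.
- rewrite [X in N X](_ : _ =
     - (((f y - f x) * (w - x) - (f w - f x) * (y - x)) * f w +
        (f w - f x) * (y - x) * (f w - f y)) / (f x * f y * f w)); last first.
    by field; rewrite ?fx0 ?fy0 ?fw0.
  rewrite cnormM cnormV cnormN !cnormM.
  set D := N (y - w) * N (y - x) * N (w - x) in h3 *.
  have D0 : 0 <= D by rewrite !mulr_ge0 ?cnorm_ge0.
  have e : N (((f y - f x) * (w - x) - (f w - f x) * (y - x)) * f w +
        (f w - f x) * (y - x) * (f w - f y)) <= 2 * M ^+ 2 * D.
    apply: le_trans (cnormD _ _) _; rewrite !cnormM (cnorm_distC (f w) (f y)).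
    have -> : 2 * M ^+ 2 * D = M * D * M + M * N (w - x) * N (y - x) * (M * N (y - w)).
      by rewrite /D; ring.
    apply: lerD; first by rewrite ler_pM ?cnorm_ge0.
    by rewrite ler_pM ?mulr_ge0 ?cnorm_ge0// ler_pM ?cnorm_ge0.
  apply: le_trans (_ : 2 * M ^+ 2 / c ^+ 3 * D <= _); last first.
    by rewrite ler_wpM2r//; lra.
  rewrite (mulrAC _ _ D) ler_pM ?cnorm_ge0 ?invr_ge0 ?mulr_ge0 ?cnorm_ge0//.
  rewrite lef_pV2 ?posrE ?mulr_gt0 ?cnorm_gt0 ?exprn_gt0//.
  by rewrite exprSr expr2 ler_pM ?mulr_ge0//; apply: ler_pM.
Qed.

Lemma C11_div f g z : C11 f z -> C11 g z -> g z != 0 -> C11 (fun x => f x / g x) z.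
Proof. by move=> hf hg g0; apply: C11M => //; apply: C11V. Qed.

Lemma C11_sum (I : Type) (s : seq I) (F : I -> R[i] -> R[i]) z :
  (forall i, C11 (F i) z) -> C11 (fun x => \sum_(i <- s) F i x) z.
Proof.
move=> h; elim: s => [|i s IH].
  apply: (@C11_ext (fun=> 0) _ _ 1) => // [x _|]; first by rewrite big_nil.
  exact: C11_cst.
apply: (@C11_ext (fun x => F i x + \sum_(i <- s) F i x) _ _ 1) => // [x _|].
  by rewrite big_cons.
exact: C11D.
Qed.

Lemma C11X f z n : C11 f z -> C11 (fun x => f x ^+ n) z.
Proof.
move=> h; elim: n => [|n IH]; first exact: C11_cst.
apply: (@C11_ext (fun x => f x * f x ^+ n) _ _ 1) => // [x _|].
  by rewrite exprS.
exact: C11M.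
Qed.

End C11.

(** * Mean values over roots of unity *)

Lemma small_mul_invn (R : realType) (a e : R) : 0 < e ->
  exists m : nat, a / m.+1%:R < e.
Proof.
move=> e0; have := archi_boundP (normr_ge0 (a / e)).
set m := Num.bound _ => hm; exists m.
rewrite ltr_pdivrMr// -ltr_pdivrMl// mulrC.
apply: le_lt_trans (ler_norm _) _; apply: lt_trans hm _.
by rewrite ltr_nat.
Qed.

(** Start at -1 and repeatedly take the square root w nearer to 1. Since |w - 1| |w + 1| is the old
    distance and |w + 1|^2 + |w - 1|^2 = 4 forces |w + 1| >= 4/3, the distance shrinks at least by
    the factor 3/4, which suffices for the bound 6/(k + 3). *)
Lemma root_unity_near1_step (R : realType) (k : nat) :
  exists n (om : R[i]), [/\ (0 < n)%N, om ^+ n = 1, om != 1, cnorm om = 1 &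
    cnorm (om - 1) <= 6 / (k + 3)%:R].
Proof.
elim: k => [|k [n [om [n0 omn om1 nom hom]]]].
  exists 2%N, (-1); rewrite cnormN cnorm1 sqrrN expr1n; split=> //.
    by rewrite -subr_eq0 -opprD oppr_eq0 (eqr_nat _ 2 0).
  by have := cnormB (-1 : R[i]) 1; rewrite cnormN cnorm1 add0n; lra.
have [w w2 wle] : exists2 w : R[i], w ^+ 2 = om & cnorm (w - 1) <= cnorm (w + 1).
  have /orP[h|h] := le_total (cnorm (sqrtC om - 1)) (cnorm (sqrtC om + 1)).
    by exists (sqrtC om); rewrite ?sqrtCK.
  exists (- sqrtC om); first by rewrite sqrrN sqrtCK.
  have -> : - sqrtC om - 1 = - (sqrtC om + 1) by ring.
  have -> : - sqrtC om + 1 = - (sqrtC om - 1) by ring.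
  by rewrite !cnormN.
have nw : cnorm w = 1.
  have : cnorm w ^+ 2 = 1 by rewrite -cnormX w2.
  by move/eqP; rewrite sqrp_eq1 ?cnorm_ge0// => /eqP.
exists (2 * n)%N, w; split => //.
- by rewrite muln_gt0.
- by rewrite exprM w2.
- by apply: contraNneq om1 => w1; rewrite -w2 w1 expr1n.
have par : cnorm (w + 1) ^+ 2 + cnorm (w - 1) ^+ 2 = 4.
  apply: (@complexI R); rewrite rmorphD /= -!mulr_cconj.
  rewrite !rmorphB !rmorphD !rmorph1 /=.
  have -> : (w + 1) * (Num.conj w + 1) + (w - 1) * (Num.conj w - 1) =
     2 * (w * Num.conj w) + 2 by ring.
  by rewrite mulr_cconj nw expr1n rmorph1; ring.
have prod : cnorm (w - 1) * cnorm (w + 1) = cnorm (om - 1).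
  by rewrite -cnormM -w2; congr cnorm; ring.
have := cnorm_ge0 (w - 1); have := cnorm_ge0 (w + 1).
move: prod par wle hom; move: (cnorm _) (cnorm _) (cnorm _) => c a b e1 e2 ab hc a0 b0.
have a43 : 4 / 3 <= a by nra.
have h34 : b <= 3 / 4 * c by rewrite -e1; nra.
have : 3 / 4 * (6 / (k + 3)%:R) <= 6 / (k.+1 + 3)%:R :> R.
  have -> : (k + 3)%:R = k%:R + 3 :> R by rewrite natrD.
  have -> : (k.+1 + 3)%:R = k%:R + 4 :> R by rewrite addSnnS natrD.
  have : 0 <= k%:R :> R by []; move: (k%:R : R) => q q0.
  have q3 : 0 < q + 3 by lra.
  have q4 : 0 < q + 4 by lra.
  by rewrite mulrA ler_pdivrMr// [leRHS]mulrAC ler_pdivlMr//; lra.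
by move: h34 hc; lra.
Qed.

Lemma root_unity_near1 (R : realType) (e : R) : 0 < e ->
  exists n (om : R[i]), [/\ (0 < n)%N, om ^+ n = 1, om != 1, cnorm om = 1 &
    cnorm (om - 1) <= e].
Proof.
move=> e0; have [k hk] := small_mul_invn 6 e0.
have [n [om [n0 h1 h2 h3 h4]]] := root_unity_near1_step R k.
exists n, om; split=> //; apply: le_trans h4 (le_trans _ (ltW hk)).
by rewrite ler_wpM2l// lef_pV2 ?posrE ?ltr0n ?addn3// ler_nat -addn2 leq_addr.
Qed.

Section MeanValue.
Variables (R : realType) (f : R[i] -> R[i]) (z : R[i]) (r0 M : R).
Local Notation N := (@cnorm R).
Hypothesis M0 : 0 <= M.
Hypothesis hf : forall x y w : R[i],
    N (x - z) < r0 -> N (y - z) < r0 -> N (w - z) < r0 ->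
    [/\ N (f x) <= M, N (f y - f x) <= M * N (y - x) &
      N ((f y - f x) * (w - x) - (f w - f x) * (y - x)) <=
      M * (N (y - w) * N (y - x) * N (w - x))].
Variables (n : nat) (om : R[i]).
Hypotheses (omn : om ^+ n = 1) (om1 : om != 1) (nom : N om = 1).

Let A (s : R) := \sum_(k < n) f (z + s%:C%C * om ^+ k).

Let nomX k : N (om ^+ k) = 1. Proof. by rewrite cnormX nom expr1n. Qed.

Let in_ball (s : R) k : 0 <= s -> s < r0 -> N (z + s%:C%C * om ^+ k - z) < r0.
Proof. by move=> s0 sr; rewrite addrC addKr cnormM nomX mulr1 cnorm_real ger0_norm. Qed.

Let telescope (s : R) :
  \sum_(k < n) (f (z + s%:C%C * om ^+ k.+1) - f (z + s%:C%C * om ^+ k)) = 0.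
Proof.
rewrite -(big_mkord xpredT (fun k => f (z + s%:C%C * om ^+ k.+1)
   - f (z + s%:C%C * om ^+ k))) telescope_sumr //.
by rewrite omn expr0 subrr.
Qed.

(* The difference quotients of [f] in the radial and the tangential direction
   nearly agree at each of the [n] nodes, and the tangential increments
   telescope to [0]. *)
Let step (s h : R) : 0 < s -> 0 < h -> s + h < r0 ->
  N (A (s + h) - A s) <= n%:R * (M * (s * N (om - 1) + h) * h).
Proof.
move=> s0 h0 sh; have [sge0 hge0] := (ltW s0, ltW h0).
pose D k := h%:C%C * (f (z + s%:C%C * om ^+ k.+1) - f (z + s%:C%C * om ^+ k))
  - s%:C%C * (om - 1) * (f (z + (s + h)%:C%C * om ^+ k) - f (z + s%:C%C * om ^+ k)).
have d0 : 0 < N (om - 1) by rewrite cnorm_gt0 subr_eq0.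
have hD k : N (D k) <= s * N (om - 1) * (M * (s * N (om - 1) + h) * h).
  set x := z + s%:C%C * om ^+ k; set y := z + s%:C%C * om ^+ k.+1.
  set w := z + (s + h)%:C%C * om ^+ k.
  have [||| _ _] := @hf x y w; try by apply: in_ball; lra.
  have wx : w - x = h%:C%C * om ^+ k by rewrite /w /x rmorphD /=; ring.
  have yx : y - x = s%:C%C * om ^+ k * (om - 1) by rewrite /y /x exprS; ring.
  have -> : (f y - f x) * (w - x) - (f w - f x) * (y - x) = om ^+ k * D k.
    by rewrite wx yx /D -/x -/y -/w; ring.
  rewrite cnormM nomX mul1r wx yx !cnormM nomX !mulr1 !cnorm_real !gtr0_norm//.
  move/le_trans; apply.
  have yw : N (y - w) <= s * N (om - 1) + h.
    have -> : y - w = (y - x) - (w - x) by ring.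
    apply: le_trans (cnormB _ _) _.
    by rewrite wx yx !cnormM nomX !mulr1 !cnorm_real !gtr0_norm.
  have -> : s * N (om - 1) * (M * (s * N (om - 1) + h) * h) =
      M * ((s * N (om - 1) + h) * (s * N (om - 1)) * h) by ring.
  rewrite ler_wpM2l// ler_wpM2r// ler_wpM2r//.
  by rewrite mulr_ge0// ltW.
have sD : \sum_(k < n) D k = - (s%:C%C * (om - 1) * (A (s + h) - A s)).
  by rewrite /D sumrB -!mulr_sumr telescope mulr0 sub0r sumrB.
have := cnorm_sum (index_enum 'I_n) xpredT D; rewrite sD cnormN !cnormM.
rewrite cnorm_real gtr0_norm// => h1.
rewrite -(ler_pM2l (mulr_gt0 s0 d0)); apply: le_trans h1 _.
have h2 : \sum_(k < n) N (D k) <=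
    \sum_(k < n) s * N (om - 1) * (M * (s * N (om - 1) + h) * h).
  by apply: ler_sum => k _; apply: hD.
apply: le_trans h2 _.
by rewrite sumr_const card_ord -[leLHS]mulr_natl mulrCA lexx.
Qed.

(** Adds up [step] over the radii h, 2h, ..., r with h = r/(m + 1), starting from the Lipschitz
    bound at radius h. As m grows, only the tangential error, proportional to |om - 1|, survives. *)
Lemma mean_value (r : R) : 0 < r -> r < r0 ->
  N (A r - n%:R * f z) <= n%:R * (M * r ^+ 2 * N (om - 1)).
Proof.
move=> rp rr0; set d := N (om - 1).
have d0 : 0 <= d by apply: cnorm_ge0.
have nR : 0 <= n%:R :> R by [].
(* The last term is n M r h + n M h: the radial part of the errors in [step], and the comparison of
   the first circle with the centre. *)
suff H m : N (A r - n%:R * f z) <= n%:R * (M * r ^+ 2 * d) +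
    n%:R * M * (r ^+ 2 + r) / m.+1%:R.
  rewrite leNgt; apply/negP; rewrite -subr_gt0 => e0.
  have [m] := small_mul_invn (n%:R * M * (r ^+ 2 + r)) e0.
  move: (H m); move: (_ / _) (n%:R * _) (N _) => t u v; lra.
pose h := r / m.+1%:R; have h0 : 0 < h by rewrite divr_gt0.
have [rge0 hge0] := (ltW rp, ltW h0).
have hmr : m.+1%:R * h = r by rewrite /h mulrC divfK// pnatr_eq0.
have hr : h <= r by rewrite -hmr ler_peMl// ler1n.
have first : N (A h - n%:R * f z) <= n%:R * (M * h).
  have -> : A h - n%:R * f z = \sum_(k < n) (f (z + h%:C%C * om ^+ k) - f z).
    by rewrite sumrB sumr_const card_ord mulr_natl.
  apply: le_trans (cnorm_sum _ _ _) _.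
  rewrite -[X in X%:R](card_ord n) mulr_natl -sumr_const; apply: ler_sum => k _.
  have [|||_ + _] := @hf z (z + h%:C%C * om ^+ k) z; rewrite ?subrr ?cnorm0 ?in_ball//.
    by lra. by lra. by lra.
  by rewrite [z + _]addrC addrK cnormM nomX mulr1 cnorm_real gtr0_norm.
have iter j : (j <= m)%N -> N (A (j.+1%:R * h) - A h) <=
    j%:R * (n%:R * (M * (r * d + h) * h)).
  elim: j => [_|j IH jm]; first by rewrite mul1r subrr cnorm0 mul0r.
  have jr : j.+2%:R * h <= r by rewrite -hmr ler_wpM2r// ler_nat.
  have jh : j.+2%:R * h = j.+1%:R * h + h by rewrite -natr1 mulrDl mul1r.
  have s0 : 0 < j.+1%:R * h by rewrite mulr_gt0.
  have st := step s0 h0; rewrite -jh in st.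
  have {}st : N (A (j.+2%:R * h) - A (j.+1%:R * h)) <=
      n%:R * (M * (r * d + h) * h).
    apply: le_trans (st _) _; first by lra.
    rewrite ler_wpM2l// ler_wpM2r// ler_wpM2l// lerD2r ler_wpM2r//.
    by lra.
  have := cnorm_dist_triangle (A (j.+1%:R * h)) (A (j.+2%:R * h)) (A h).
  have KE (K : R) : j.+1%:R * K = j%:R * K + K by rewrite -natr1 mulrDl mul1r.
  have := IH (ltnW jm); move: st; rewrite (KE (n%:R * _)).
  move: (n%:R * _) (N _) (N _) (N _) => K a b c; move: (j%:R * K) => t; lra.
have := iter m (leqnn m); rewrite hmr => it.
have := cnorm_dist_triangle (A h) (A r) (n%:R * f z).
have K0 : 0 <= n%:R * (M * (r * d + h) * h).
  by do 3![apply: mulr_ge0 => //]; apply: addr_ge0 => //; apply: mulr_ge0.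
have : m%:R * (n%:R * (M * (r * d + h) * h)) <= n%:R * M * (r * d + h) * r.
  rewrite -[X in _ <= _ * X]hmr -natr1.
  have -> : n%:R * M * (r * d + h) * ((m%:R + 1) * h) =
    m%:R * (n%:R * (M * (r * d + h) * h)) + n%:R * (M * (r * d + h) * h) by ring.
  by lra.
have -> : n%:R * M * (r * d + h) * r = n%:R * (M * r ^+ 2 * d) + n%:R * M * r * h by ring.
have -> : n%:R * M * (r ^+ 2 + r) / m.+1%:R = n%:R * M * r * h + n%:R * (M * h).
  by rewrite /h; ring.
by move: first it; lra.
Qed.

Lemma sum_root_unity : \sum_(k < n) om ^+ k = 0.
Proof.
apply/eqP; have := subrX1 om n; rewrite omn subrr => /esym/eqP.
by rewrite mulf_eq0 subr_eq0 (negPf om1).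
Qed.

End MeanValue.

(** * The maximum principle *)

Lemma cnorm_le_ReIm (R : realType) (a b : R) : cnorm (a +i* b)%C <= `|a| + `|b|.
Proof.
have -> : (a +i* b)%C = a%:C%C + 'i%C * b%:C%C by simpc.
apply: le_trans (cnormD _ _) _; rewrite cnormM !cnorm_real.
suff -> : cnorm ('i%C : R[i]) = 1 by rewrite mul1r.
by rewrite /cnorm normc_def /= expr0n expr1n add0r sqrtr1.
Qed.

Lemma ReIm_le_cnorm (R : realType) (z : R[i]) :
  `|complex.Re z| <= cnorm z /\ `|complex.Im z| <= cnorm z.
Proof.
rewrite -!sqrtr_sqr /cnorm normc_def /=.
by split; rewrite ler_sqrt ?addr_ge0 ?sqr_ge0// (lerDl, lerDr) sqr_ge0.
Qed.

(* Compactness of the closed disk, in the form of an induction principle. *)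
Lemma disk_ind (R : realType) (rho : R) (Q : set R[i] -> Prop) : rho <= 1 ->
  Q set0 -> (forall A B, A `<=` B -> Q B -> Q A) ->
  (forall A B, Q A -> Q B -> Q (A `|` B)) ->
  (forall p, cnorm p <= rho -> exists2 e : R, 0 < e & Q [set x | cnorm (x - p) < e]) ->
  Q [set x | cnorm x <= rho].
Proof.
move=> rho1 Q0 Qsub QU Qloc; set K := [set x | _]; apply: contrapT => nQ.
pose toC (p : R * R) : R[i] := (p.1 +i* p.2)%C.
(* If [Q K] fails, the sets whose complement in [K] satisfies [Q] form a proper filter on the plane.
   It contains a compact square, and a cluster point there contradicts the local hypothesis. *)
pose F : set_system (R * R) := fun A => Q (K `&` [set x | forall p, toC p = x -> ~ A p]).
pose S : set (R * R) := `[-1, 1] `*` `[-1, 1].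
have Scompact : compact S by apply: compact_setX; apply: segment_compact.
have FF : ProperFilter F.
  apply: Build_ProperFilter.
    move=> h; apply: nQ; apply: Qsub h => x Kx; split => // p _; exact.
  split.
  - by apply: Qsub Q0 => -[a b] [_ /(_ (a, b) erefl)]; apply.
  - move=> A B FA FB; apply: Qsub (QU _ _ FA FB) => -[a b] [Kx h].
    have [Aab|nA] := pselect (A (a, b)).
      right; split => // -[c d] [-> ->] Bab; exact: h (a, b) erefl (conj Aab Bab).
    by left; split => // -[c d] [-> ->].
  - move=> A B AB; apply: Qsub => x [Kx h]; split => // p px Ap.
    by apply: (h p px); apply: AB.
have FS : F S.
  apply: Qsub Q0 => -[a b] [Kx /(_ (a, b) erefl)]; apply.
  have [h1 h2] := ReIm_le_cnorm (a +i* b)%C.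
  rewrite /S /= !in_itv /= -!ler_norml.
  by split; apply: le_trans rho1; [apply: le_trans h1 _|apply: le_trans h2 _].
have [[a b] [_ cl]] := Scompact F FF FS.
have [e e0 He] : exists2 e : R, 0 < e &
    Q (K `&` [set x | cnorm (x - toC (a, b)) < e]).
  have [h|h] := leP (cnorm (toC (a, b))) rho.
    by have [e e0 h'] := Qloc _ h; exists e => //; apply: Qsub h' => x [].
  exists (cnorm (toC (a, b)) - rho); first by rewrite subr_gt0.
  apply: Qsub Q0 => x [Kx /= hx]; have := cnorm_sub_ge (toC (a, b)) x.
  by rewrite cnorm_distC; move: Kx hx; rewrite /K /=; lra.
pose U := [set p : R * R | `|p.1 - a| < e / 2 /\ `|p.2 - b| < e / 2].
have Unear p : U p -> cnorm (toC p - toC (a, b)) < e.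
  move=> [h1 h2]; have := cnorm_le_ReIm (p.1 - a) (p.2 - b).
  have -> : ((p.1 - a) +i* (p.2 - b))%C = toC p - toC (a, b) by [].
  by move: h1 h2; lra.
have e20 : 0 < e / 2 by lra.
have [||[c d] [nU Ucd]] := cl (~` U) U.
- apply: Qsub He => x [Kx h]; split => //=.
  case: x Kx h => c d Kx /(_ (c, d) erefl) /contrapT; exact: Unear.
- exists ([set x | `|x - a| < e / 2], [set x | `|x - b| < e / 2]) => /=.
    split; apply/nbhs_ballP; exists (e / 2) => // x;
    by rewrite /ball /= distrC.
  by move=> [x y] [].
- exact: nU Ucd.
Qed.

(** Without a maximum, each p has some q with u p < u q, and by semicontinuity u < u q near p. Being
    dominated by one value u q is stable under unions, so by [disk_ind] some u q would dominate the
    whole disk, including q. *)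
Lemma usc_attains_max (R : realType) (rho : R) (u : R[i] -> R) :
  0 <= rho -> rho <= 1 ->
  (forall p, cnorm p <= rho -> forall e, 0 < e -> exists2 d, 0 < d &
     forall x, cnorm x <= rho -> cnorm (x - p) < d -> u x < u p + e) ->
  exists2 p, cnorm p <= rho & forall x, cnorm x <= rho -> u x <= u p.
Proof.
move=> rho0 rho1 usc; apply: contrapT => nomax.
have bigger p : cnorm p <= rho -> exists2 q, cnorm q <= rho & u p < u q.
  move=> hp; apply: contrapT => np; apply: nomax; exists p => // x hx.
  by rewrite leNgt; apply/negP => h; apply: np; exists x.
pose Q (A : set R[i]) := exists2 q, cnorm q <= rho &
   forall x, A x -> cnorm x <= rho -> u x < u q.
have [||||q hq] := @disk_ind R rho Q rho1.
- by exists 0; rewrite ?cnorm0.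
- by move=> A B AB [q hq h]; exists q => // x /AB; apply: h.
- move=> A B [q hq h] [q' hq' h'].
  have /orP[qq'|qq'] := le_total (u q) (u q').
    by exists q' => // x [Ax|Bx] hx; [apply: lt_le_trans qq'; apply: h|apply: h'].
  by exists q => // x [Ax|Bx] hx; [apply: h|apply: lt_le_trans qq'; apply: h'].
- move=> p hp; have [q hq pq] := bigger p hp.
  have [|d d0 hd] := usc p hp (u q - u p); first by rewrite subr_gt0.
  exists d => //; exists q => // x xp hx.
  by have := hd x hx xp; rewrite addrC subrK.
by move=> /(_ q hq hq); rewrite ltxx.
Qed.

(** At an interior maximum q of |G| + ep |x|^2, averaging over a small circle of radius s gains ep
    s^2 from the second term, while [mean_value] loses at most M s^2 |om - 1| from the first, which
    is smaller once [om] is near 1. The alternative G p = 0 serves functions extended by 0 over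
    exceptional points. *)
Lemma max_principle (R : realType) (G : R[i] -> R[i]) (rho C : R) :
  0 <= rho -> rho <= 1 -> 0 <= C ->
  (forall p, cnorm p <= rho -> forall e, 0 < e -> exists2 d, 0 < d &
     forall x, cnorm x <= rho -> cnorm (x - p) < d ->
       cnorm (G x) < cnorm (G p) + e) ->
  (forall p, cnorm p < rho -> G p = 0 \/ C11 G p) ->
  (forall p, cnorm p = rho -> cnorm (G p) <= C) ->
  forall p, cnorm p <= rho -> cnorm (G p) <= C.
Proof.
move=> rho0 rho1 C0 usc hG bd p hp; rewrite leNgt; apply/negP => hC.
(* As |x| <= 1, the perturbation is at most ep, so |G| still exceeds C at the maximum of the
   perturbed function. *)
have [ep ep0 epE] : exists2 ep, 0 < ep & cnorm (G p) = C + 2 * ep.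
  by exists ((cnorm (G p) - C) / 2); [lra|field].
pose u x := cnorm (G x) + ep * cnorm x ^+ 2.
have sq1 x : cnorm x <= rho -> 0 <= cnorm x ^+ 2 <= 1.
  move=> hx; rewrite exprn_ge0 ?cnorm_ge0// exprn_ile1 ?cnorm_ge0//.
  exact: le_trans rho1.
have [q hq umax] : exists2 q, cnorm q <= rho & forall x, cnorm x <= rho -> u x <= u q.
  apply: usc_attains_max => // x hx e e0.
  have e20 : 0 < e / 2 by lra.
  have [d d0 hd] := usc x hx _ e20.
  exists (Num.min d (e / (4 * ep))).
    by rewrite lt_min d0 divr_gt0// mulr_gt0.
  move=> y hy; rewrite lt_min => /andP[yd]; rewrite ltr_pdivlMr ?mulr_gt0// => ye.
  have := hd y hy yd; rewrite /u.
  have : cnorm y ^+ 2 - cnorm x ^+ 2 <= 2 * cnorm (y - x).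
    have := cnorm_sub_ge y x; have := cnorm_ge0 y; have := cnorm_ge0 x.
    have := cnorm_ge0 (y - x).
    have := le_trans hx rho1; have := le_trans hy rho1; nra.
  move: ye ep0; set a := cnorm y ^+ 2; set b := cnorm x ^+ 2; nra.
have upq := umax p hp.
have Gq : C < cnorm (G q).
  have /andP[_ s1] := sq1 _ hq; have /andP[s0 _] := sq1 _ hp.
  have : ep * cnorm q ^+ 2 <= ep by rewrite ler_piMr// ltW.
  have : 0 <= ep * cnorm p ^+ 2 by rewrite mulr_ge0// ltW.
  by move: upq; rewrite /u; lra.
have {}hq : cnorm q < rho.
  rewrite lt_neqAle hq andbT; apply/eqP => /bd; move: Gq; lra.
have [G0|[r [M [r0 M0 hM]]]] := hG q hq.
  by move: Gq; rewrite G0 cnorm0; lra.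
have [|n [om [n0 omn om1 nom hom]]] := @root_unity_near1 R (ep / (2 * (M + 1))).
  by rewrite divr_gt0// mulr_gt0// ltr_wpDl.
have [s [s0 sr srho]] : exists s, [/\ 0 < s, s < r & s < rho - cnorm q].
  have h : 0 < Num.min r (rho - cnorm q) by rewrite lt_min r0 subr_gt0.
  exists (Num.min r (rho - cnorm q) / 2).
  have : Num.min r (rho - cnorm q) <= r by rewrite ge_min lexx.
  have : Num.min r (rho - cnorm q) <= rho - cnorm q by rewrite ge_min lexx orbT.
  by move: h; split; lra.
have := mean_value M0 hM omn om1 nom s0 sr.
set A := \sum_(k < n) _ => hA.
pose y (k : 'I_n) := q + s%:C%C * om ^+ k.
have ny k : cnorm (y k - q) = s.
  by rewrite /y addrC addKr cnormM cnormX nom expr1n mulr1 cnorm_real gtr0_norm.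
have yk k : cnorm (y k) <= rho.
  by have := cnorm_sub_ge (y k) q; rewrite ny; move: srho; lra.
(* The cross terms cancel because the powers of [om] sum to 0. *)
have sumsq : \sum_(k < n) cnorm (y k) ^+ 2 = n%:R * (cnorm q ^+ 2 + s ^+ 2).
  apply: (@complexI R); rewrite rmorph_sum /=.
  have e k : (cnorm (y k) ^+ 2)%:C%C = (cnorm q ^+ 2 + s ^+ 2)%:C%C +
      (Num.conj q * s%:C%C * om ^+ k + Num.conj (Num.conj q * s%:C%C * om ^+ k)).
    have cs : Num.conj (s%:C%C : R[i]) = s%:C%C.
      by apply/CrealP; rewrite complex_real.
    rewrite -(mulr_cconj (y k)) (rmorphD (real_complex R)) /= -(mulr_cconj q).
    have -> : (s ^+ 2)%:C%C = s%:C%C * Num.conj s%:C%C * (om ^+ k * Num.conj (om ^+ k)) :> R[i].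
      by rewrite (mulr_cconj (om ^+ k)) cnormX nom !expr1n rmorph1 mulr1 cs rmorphXn.
    by rewrite /y !(rmorphD, rmorphM) /= conjCK cs; ring.
  under eq_bigr => k _ do rewrite e.
  rewrite big_split /= sumr_const card_ord big_split /= -rmorph_sum -mulr_sumr.
  by rewrite (sum_root_unity omn om1) mulr0 rmorph0 !addr0 rmorphM /= rmorph_nat mulr_natl.
have sumu : \sum_(k < n) u (y k) <= n%:R * u q.
  rewrite mulr_natl -[X in _ *+ X](card_ord n) -sumr_const.
  by apply: ler_sum => k _; apply: umax.
have sumG : n%:R * cnorm (G q) <= \sum_(k < n) cnorm (G (y k)) +
    n%:R * (M * s ^+ 2 * cnorm (om - 1)).
  have := cnorm_sub_ge (n%:R * G q) A; rewrite cnorm_distC cnormM cnorm_nat.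
  have := cnorm_sum (index_enum 'I_n) xpredT (fun k => G (y k)); rewrite -/A.
  by move: hA; lra.
move: sumu; rewrite /u big_split /= -mulr_sumr sumsq => sumu.
have np : 0 < n%:R :> R by rewrite ltr0n.
have small : M * s ^+ 2 * cnorm (om - 1) < ep * s ^+ 2.
  rewrite mulrAC ltr_pM2r ?exprn_gt0//.
  have : M * cnorm (om - 1) <= M * (ep / (2 * (M + 1))) by rewrite ler_wpM2l.
  have : M * (ep / (2 * (M + 1))) < ep.
    by rewrite mulrA ltr_pdivrMr; nra.
  lra.
have : n%:R * (M * s ^+ 2 * cnorm (om - 1)) < n%:R * (ep * s ^+ 2) by rewrite ltr_pM2l.
by move: sumu sumG; lra.
Qed.

(** No accumulation points in the open disk, with real radii. Points outside the disk are allowed,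
    so any finite set can be adjoined. *)
Definition sparse (R : realType) (E : set R[i]) : Prop :=
  forall w, cnorm w < 1 -> exists2 r : R, 0 < r &
    forall l, E l -> l != w -> r <= cnorm (l - w).

Lemma discrete_sparse (R : realType) (L : set R[i]) : discrete_set L -> sparse L.
Proof.
move=> [_ _ h] w w1; have [|r r0 hr] := h w; first by rewrite /disk /= diskE.
have rr : r \is Num.real by rewrite realE ltW.
exists (complex.Re r); first by rewrite -ltcR RRe_real.
by move=> l Ll lw; rewrite -lecR RRe_real// -cnormE hr.
Qed.

Lemma sparseU1 (R : realType) (E : set R[i]) a : sparse E -> sparse (E `|` [set a]).
Proof.
move=> hE w w1; have [r r0 hr] := hE w w1.
have [->|aw] := eqVneq a w.
  by exists r => // l [El|->] lw; [exact: hr|rewrite eqxx in lw].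
exists (Num.min r (cnorm (a - w))); first by rewrite lt_min r0 cnorm_gt0 subr_eq0.
by move=> l [El|->] lw; rewrite ge_min ?lexx ?orbT// hr.
Qed.

Lemma sparseUseq (R : realType) (E : set R[i]) (s : seq R[i]) :
  sparse E -> sparse (E `|` [set x | x \in s]).
Proof.
move=> hE; elim: s => [|a s IH].
  suff -> : E `|` [set x | x \in [::]] = E by [].
  by apply/seteqP; split => x; [case|left].
suff -> : E `|` [set x | x \in a :: s] = E `|` [set x | x \in s] `|` [set a].
  exact: sparseU1.
apply/seteqP; split => x /=; rewrite inE.
  by move=> [|/orP[/eqP|]]; [left; left|right|left; right].
by move=> [[|->]|->]; [left|right; apply/orP; right|right; rewrite eqxx].
Qed.

Lemma sparse_ball (R : realType) (E : set R[i]) w : sparse E -> cnorm w < 1 ->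
  ~ E w -> exists2 r : R, 0 < r & forall x, cnorm (x - w) < r -> ~ E x.
Proof.
move=> hE w1 Ew; have [r r0 hr] := hE w w1; exists r => // x xr Ex.
have := hr x Ex; case: eqVneq => [xw|_ /(_ isT)]; first by rewrite xw in Ex.
by move: xr; lra.
Qed.

(** By compactness: each point of the closed disk has a ball meeting [E] at most in its centre. *)
Lemma sparse_finite (R : realType) (E : set R[i]) (rho : R) : sparse E ->
  rho < 1 -> exists s : seq R[i], forall x, x \in s <-> E x /\ cnorm x <= rho.
Proof.
move=> hE rho1.
pose Q (A : set R[i]) := exists s : seq R[i], forall x, A x -> E x -> x \in s.
have [||||s hs] := @disk_ind R rho Q (ltW rho1).
- by exists [::].
- by move=> A B AB [s hs]; exists s => x /AB; apply: hs.
- move=> A B [s hs] [t ht]; exists (s ++ t) => x AB Ex.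
  by rewrite mem_cat; apply/orP; case: AB => ?; [left; apply: hs|right; apply: ht].
- move=> p hp; have [r r0 hr] := hE p (le_lt_trans hp rho1).
  exists r => //; exists [:: p] => x /= xr Ex; rewrite inE.
  by apply/negPn/negP => xp; have := hr x Ex xp; move: xr; lra.
exists [seq x <- s | `[< E x /\ cnorm x <= rho >]] => x.
rewrite mem_filter; split => [/andP[/asboolP]//|[Ex hx]].
by rewrite hs// andbT; apply/asboolP.
Qed.

Lemma bernoulli_ge (R : realType) (t : R) n : 0 <= t -> 1 + n%:R * t <= (1 + t) ^+ n.
Proof.
move=> t0; elim: n => [|n IH]; first by rewrite mul0r addr0 expr0.
rewrite exprS -natr1; have nt : 0 <= n%:R * t by rewrite mulr_ge0.
have : 0 <= n%:R * t * t by rewrite mulr_ge0.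
have : (1 + t) * (1 + n%:R * t) <= (1 + t) * (1 + t) ^+ n by rewrite ler_wpM2l ?addr_ge0.
lra.
Qed.

(** * Maximum principle for bounded functions off a sparse set *)

Section BoundedMax.
Variables (R : realType) (E : set R[i]) (F : R[i] -> R[i]) (B : R).
Local Notation N := (@cnorm R).
Hypothesis hE : sparse E.
Hypothesis FC : forall x, N x < 1 -> ~ E x -> C11 F x.
Hypothesis FB : forall x, N x < 1 -> ~ E x -> N (F x) <= B.
Hypothesis Fbd : forall d : R, 0 < d -> exists2 rho, rho < 1 &
  forall x, rho <= N x -> N x < 1 -> ~ E x -> N (F x) <= 1 + d.

(* Maximum principle for [F^n * prod (x - e)/2], which extends continuously by
   [0] over the exceptional points, then [n --> oo]. *)
Lemma bounded_max x : N x < 1 -> ~ E x -> N (F x) <= 1.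
Proof.
move=> x1 Ex; rewrite leNgt; apply/negP => Fx.
have [d d0 dE] : exists2 d, 0 < d & N (F x) = 1 + 2 * d.
  by exists ((N (F x) - 1) / 2); [lra|field].
have [rho0 rho01 hrho0] := Fbd d0.
(* The disk of radius rho contains x, and |F| <= 1 + d on its boundary circle off [E]. *)
pose rho := Num.max rho0 (N x).
have rho1 : rho < 1 by rewrite gt_max rho01.
have rhox : N x <= rho by rewrite le_max lexx orbT.
have rhoge0 : 0 <= rho := le_trans (cnorm_ge0 _) rhox.
have rho0rho : rho0 <= rho by rewrite le_max lexx.
have [s hs] := sparse_finite hE rho1.
have B0 : 0 <= B := le_trans (cnorm_ge0 _) (FB x1 Ex).
pose p y : R[i] := \prod_(e <- s) ((y - e) / 2).
have fac1 y e : N y <= rho -> e \in s -> N ((y - e) / 2) <= 1.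
  move=> hy /hs[_ he]; rewrite cnormM cnormV cnorm_nat ler_pdivrMr// mul1r.
  by have := cnormB y e; move: rho1 hy he; lra.
have p1 y (t : seq R[i]) : N y <= rho -> {subset t <= s} ->
    N (\prod_(e <- t) ((y - e) / 2)) <= 1.
  move=> hy; elim: t => [_|e t IH st]; first by rewrite big_nil cnorm1.
  rewrite big_cons cnormM mulr_ile1 ?cnorm_ge0//.
    by apply: fac1 => //; apply: st; rewrite mem_head.
  by apply: IH => u ut; apply: st; rewrite inE ut orbT.
have pe y e : N y <= rho -> e \in s -> N (p y) <= N (y - e).
  move=> hy es; rewrite /p (big_rem e es) /= cnormM.
  have h : N (\prod_(u <- rem e s) ((y - u) / 2)) <= 1.
    by apply: p1 => // u; apply: mem_rem.
  apply: le_trans (ler_piMr (cnorm_ge0 _) h) _.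
  rewrite cnormM cnormV cnorm_nat ler_pdivrMr//.
  by have := cnorm_ge0 (y - e); lra.
have pC y : C11 p y.
  rewrite /p; elim: (s) => [|e t IH].
    apply: (@C11_ext _ (fun=> 1) _ _ 1) => // [u _|]; first by rewrite big_nil.
    exact: C11_cst.
  apply: (@C11_ext _ (fun u => (u - e) / 2 * \prod_(e <- t) ((u - e) / 2)) _ _ 1) => // [u _|].
    by rewrite big_cons.
  apply: C11M => //; apply: C11M; last exact: C11_cst.
  by apply: C11B; [apply: C11_id|apply: C11_cst].
have px0 : 0 < N (p x).
  rewrite cnorm_gt0 /p prodf_seq_neq0; apply/allP => e es /=.
  rewrite mulf_neq0 ?invr_eq0 ?pnatr_eq0// subr_eq0.
  by apply/eqP => xe; apply: Ex; rewrite xe; have [] := (hs e).1 es.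
have key n : (1 + 2 * d) ^+ n * N (p x) <= (1 + d) ^+ n.
  (* At a point q of [E] the value 0 is upper semicontinuous for |G|, because F is bounded and p
     contains the factor (y - q) / 2. *)
  pose G y := if `[< E y >] then 0 else F y ^+ n * p y.
  have GnE y : ~ E y -> G y = F y ^+ n * p y by rewrite /G => /asboolPn/negPf ->.
  have GE y : E y -> G y = 0 by rewrite /G => /asboolP ->.
  have GC y : N y < 1 -> ~ E y -> C11 G y.
    move=> hy Ey; have [r r0 hr] := sparse_ball hE hy Ey.
    apply: (@C11_ext _ (fun u => F u ^+ n * p u) _ _ r r0).
      by move=> u /hr Eu; rewrite GnE.
    by apply: C11M => //; apply: C11X; apply: FC.
  have := @max_principle R G rho ((1 + d) ^+ n) rhoge0 (ltW rho1) _ _ _ _ x rhox.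
  rewrite GnE// cnormM cnormX dE; apply.
  - by rewrite exprn_ge0// addr_ge0// ltW.
  - move=> q hq e e0; have q1 := le_lt_trans hq rho1.
    have [Eq|Eq] := pselect (E q).
      have Bn : 0 <= B ^+ n by rewrite exprn_ge0.
      have Bn1 : 0 < B ^+ n + 1 by rewrite ltr_wpDl.
      exists (e / (B ^+ n + 1)); first by rewrite divr_gt0.
      move=> y hy; rewrite ltr_pdivlMr// => yq.
      rewrite (GE q Eq) cnorm0 add0r.
      have [Ey|Ey] := pselect (E y); first by rewrite GE// cnorm0.
      rewrite GnE// cnormM cnormX.
      have qs : q \in s by apply/hs.
      have : N (F y) ^+ n * N (p y) <= B ^+ n * N (y - q).
        apply: ler_pM; rewrite ?exprn_ge0 ?cnorm_ge0 ?pe//.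
        by rewrite lerXn2r ?nnegrE ?cnorm_ge0 ?FB// (le_lt_trans hy).
      by have := cnorm_ge0 (y - q); lra.
    have [r [M [r0 M0 hM]]] := C11_Lip (GC q q1 Eq).
    have M1 : 0 < M + 1 by rewrite ltr_wpDl.
    exists (Num.min r (e / (M + 1))).
      by rewrite lt_min r0 divr_gt0.
    move=> y hy; rewrite lt_min => /andP[/hM yM]; rewrite ltr_pdivlMr// => ye.
    by have := cnorm_sub_ge (G y) (G q); have := cnorm_ge0 (y - q); move: yM; lra.
  - move=> q hq; have [Eq|Eq] := pselect (E q); first by left; apply: GE.
    by right; apply: GC => //; apply: lt_trans rho1.
  - move=> q hq; have [Eq|Eq] := pselect (E q).
      by rewrite GE// cnorm0 exprn_ge0// addr_ge0// ltW.
    rewrite GnE// cnormM cnormX -[leRHS]mulr1 ler_pM ?exprn_ge0 ?cnorm_ge0//.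
      have d1 : 0 <= 1 + d by lra.
      by rewrite lerXn2r ?nnegrE ?cnorm_ge0//; apply: hrho0; rewrite ?hq.
    by apply: p1 => //; rewrite hq.
(* Since 1 + 2d = (1 + d)(1 + t), [key] bounds (1 + t)^n |p x| by 1 for all n, against Bernoulli's
   inequality. *)
have d1 : 0 < 1 + d by lra.
have td : 0 < d / (1 + d) by rewrite divr_gt0.
have [m] := @small_mul_invn R 1 _ (mulr_gt0 td px0).
rewrite ltr_pdivrMr//; set t := d / (1 + d) => h.
have := key m.+1; have -> : 1 + 2 * d = (1 + d) * (1 + t) by rewrite /t; field; lra.
rewrite exprMn -mulrA ger_pMr ?exprn_gt0//.
have := bernoulli_ge m.+1 (ltW td); rewrite -/t => hb.
have : (1 + m.+1%:R * t) * N (p x) <= (1 + t) ^+ m.+1 * N (p x) by rewrite ler_wpM2r// ltW.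
by move: h px0; lra.
Qed.

End BoundedMax.

(** * Schur transforms *)

Lemma qform_kernel (C : numClosedFieldType) (K : C -> C -> C) n (z : n.-tuple C) v :
  qform (kernel_mx K z) v =
  \sum_i \sum_j v 0 i * K (tnth z i) (tnth z j) * (v 0 j)^*.
Proof.
rewrite /qform mxE exchange_big; apply: eq_bigr => j _.
by rewrite !mxE mulr_suml; apply: eq_bigr => i _; rewrite !mxE.
Qed.

Lemma psd_kernel_congr (C : numClosedFieldType) (K1 K2 : C -> C -> C) (k : C)
    (c : C -> C) n (z : n.-tuple C) : 0 <= k ->
  (forall i j, K1 (tnth z i) (tnth z j) =
     k * c (tnth z i) * K2 (tnth z i) (tnth z j) * (c (tnth z j))^*) ->
  psd (kernel_mx K2 z) -> psd (kernel_mx K1 z).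
Proof.
move=> k0 hK h2 v.
suff -> : qform (kernel_mx K1 z) v =
    k * qform (kernel_mx K2 z) (\row_i (v 0 i * c (tnth z i))) by rewrite mulr_ge0.
rewrite !qform_kernel mulr_sumr; apply: eq_bigr => i _.
rewrite mulr_sumr; apply: eq_bigr => j _; rewrite hK !mxE rmorphM /=; ring.
Qed.

Lemma psd_kernel_congrV (C : numClosedFieldType) (K1 K2 : C -> C -> C) (k : C)
    (c : C -> C) n (z : n.-tuple C) : 0 < k -> (forall i, c (tnth z i) != 0) ->
  (forall i j, K1 (tnth z i) (tnth z j) =
     k * c (tnth z i) * K2 (tnth z i) (tnth z j) * (c (tnth z j))^*) ->
  psd (kernel_mx K1 z) -> psd (kernel_mx K2 z).
Proof.
move=> k0 c0 hK; apply: (@psd_kernel_congr _ _ _ k^-1 (fun x => (c x)^-1)).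
  by rewrite invr_ge0 ltW.
move=> i j; rewrite hK; have := c0 i; have := c0 j; have := lt0r_neq0 k0.
rewrite -(conjC_eq0 (c (tnth z j))) fmorphV /= => k1 cj ci; field.
by rewrite k1 ci cj.
Qed.

Lemma psd1 (C : numClosedFieldType) (K : C -> C -> C) x :
  psd (kernel_mx K [tuple x]) -> 0 <= K x x.
Proof.
move=> /(_ (const_mx 1)); rewrite qform_kernel !big_ord_recl !big_ord0 !mxE.
by rewrite rmorph1 mul1r mulr1 !addr0.
Qed.

(** Cauchy-Schwarz. The test vector depends on which diagonal entry is nonzero; when both vanish,
    (1, -K x y) gives -2 |K x y|^2 >= 0. *)
Lemma psd2 (C : numClosedFieldType) (K : C -> C -> C) x y :
  (forall u v, (K u v)^* = K v u) -> psd (kernel_mx K [tuple x; y]) ->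
  `|K x y| ^+ 2 <= K x x * K y y.
Proof.
move=> hK hp.
have Kx : 0 <= K x x.
  by apply: psd1; apply: psd_subset hp => u; rewrite !inE => ->.
have Ky : 0 <= K y y.
  by apply: psd1; apply: psd_subset hp => u; rewrite !inE => ->; rewrite orbT.
have q a b : 0 <= a * K x x * a^* + a * K x y * b^* + b * (K x y)^* * a^* + b * K y y * b^*.
  have := hp (\row_(i < 2) if i == ord0 then a else b).
  rewrite qform_kernel !big_ord_recl !big_ord0 !mxE /= !addr0.
  by rewrite /tnth /= hK !addrA.
have Kxr : (K x x)^* = K x x by rewrite hK.
have Kyr : (K y y)^* = K y y by rewrite hK.
rewrite normCK; have [Ky0|Ky0] := eqVneq (K y y) 0; last first.
  have Kyp : 0 < K y y by rewrite lt_def Ky0.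
  have := q (K y y) (- (K x y)); rewrite rmorphN /= Kyr.
  have -> : K y y * K x x * K y y + K y y * K x y * - (K x y)^* +
     - K x y * (K x y)^* * K y y + - K x y * K y y * - (K x y)^* =
     K y y * (K x x * K y y - K x y * (K x y)^*) by ring.
  by rewrite pmulr_rge0// subr_ge0.
have [Kx0|Kx0] := eqVneq (K x x) 0; last first.
  have Kxp : 0 < K x x by rewrite lt_def Kx0.
  have := q (- (K x y)^*) (K x x); rewrite rmorphN /= conjCK Kxr.
  have -> : - (K x y)^* * K x x * - K x y + - (K x y)^* * K x y * K x x +
     K x x * (K x y)^* * - K x y + K x x * K y y * K x x =
     K x x * (K x x * K y y - K x y * (K x y)^*) by ring.
  by rewrite pmulr_rge0// subr_ge0.
have := q 1 (- K x y); rewrite Kx0 Ky0 rmorphN rmorph1 /=.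
have -> : 1 * 0 * 1 + 1 * K x y * - (K x y)^* + - K x y * (K x y)^* * 1 +
    - K x y * 0 * - (K x y)^* = - (2 * (K x y * (K x y)^*)) by ring.
by rewrite oppr_ge0 mul0r pmulr_rle0.
Qed.

Section Pair.
Variable R : realType.
Local Notation N := (@cnorm R).
Implicit Types (g : R[i] -> R[i]) (x y : R[i]).

(** Hence |x - y| < |1 - x y^*| inside the disk, with equality as soon as one of the points is on
    the circle. *)
Lemma cnorm_blaschke x y :
  N (1 - x * Num.conj y) ^+ 2 - N (x - y) ^+ 2 = (1 - N x ^+ 2) * (1 - N y ^+ 2).
Proof.
apply: (@complexI R).
transitivity ((1 - x * Num.conj y) * Num.conj (1 - x * Num.conj y) -
  (x - y) * Num.conj (x - y)); first by rewrite !mulr_cconj rmorphB.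
transitivity ((1 - x * Num.conj x) * (1 - y * Num.conj y)).
  by rewrite !rmorphB !rmorphM rmorph1 /= conjCK; ring.
by rewrite !mulr_cconj -(rmorph1 (real_complex R)) -!rmorphB -rmorphM.
Qed.

Lemma pickK_diag g x :
  pickK g x x = ((1 - N (g x) ^+ 2) / (1 - N x ^+ 2))%:C%C.
Proof.
by rewrite /pickK !mulr_cconj -(rmorph1 (real_complex R)) -!rmorphB -fmorphV -rmorphM.
Qed.

Lemma sqr_lt1 x : N x < 1 -> 0 < 1 - N x ^+ 2.
Proof. by move=> x1; rewrite subr_gt0 exprn_ilt1 ?cnorm_ge0. Qed.

Lemma psd1_le1 g x : N x < 1 -> psd (kernel_mx (pickK g) [tuple x]) -> N (g x) <= 1.
Proof.
move=> x1 /psd1; rewrite pickK_diag -[0]/(0%:C%C) lecR.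
rewrite pmulr_lge0 ?invr_gt0 ?sqr_lt1// subr_ge0.
by rewrite expr_le1 ?cnorm_ge0.
Qed.

(** The Schwarz-Pick inequality: the determinant condition [psd2], rewritten by [cnorm_blaschke] at
    the points and at the values. The form without quotients also covers values of modulus 1. *)
Lemma psd2_contraction g x y : N x < 1 -> N y < 1 ->
  psd (kernel_mx (pickK g) [tuple x; y]) ->
  N (g x - g y) * N (1 - x * Num.conj y) <= N (1 - g x * Num.conj (g y)) * N (x - y).
Proof.
move=> x1 y1 /(psd2 (pickK_conj g)); rewrite !pickK_diag cnormE -rmorphM -rmorphXn lecR.
rewrite /pickK cnormM cnormV exprMn exprVn.
have := cnorm_blaschke x y; have := cnorm_blaschke (g x) (g y).
have x2 := sqr_lt1 x1; have y2 := sqr_lt1 y1.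
have B0 : 0 < N (1 - x * Num.conj y) ^+ 2.
  by rewrite exprn_gt0// cnorm_gt0 disk_neq0 ?diskE.
move=> e1 e2; rewrite mulf_div -e1 -e2 ler_pdivlMr ?e2 ?mulr_gt0//.
rewrite mulrAC ler_pdivrMr// -e2 => h.
rewrite -(ler_pXn2r (n := 2)) ?nnegrE ?mulr_ge0 ?cnorm_ge0// !exprMn.
by move: h; lra.
Qed.

Lemma psd2_lipschitz g x y (d : R) : N x < 1 -> N y < 1 -> 0 < d -> d <= 1 - N x ->
  psd (kernel_mx (pickK g) [tuple x; y]) ->
  N (g y - g x) <= 2 / d * N (y - x).
Proof.
move=> x1 y1 d0 dx hp.
have gx : N (g x) <= 1.
  by apply: psd1_le1 => //; apply: psd_subset hp => u; rewrite !inE => ->.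
have gy : N (g y) <= 1.
  by apply: psd1_le1 => //; apply: psd_subset hp => u; rewrite !inE => ->; rewrite orbT.
have := psd2_contraction x1 y1 hp; rewrite (cnorm_distC (g y)) (cnorm_distC y).
have : N (1 - g x * Num.conj (g y)) <= 2.
  apply: le_trans (cnormB _ _) _; rewrite cnorm1 cnormM cnorm_Cconj.
  by have := mulr_ile1 (cnorm_ge0 _) (cnorm_ge0 _) gx gy; lra.
have : d <= N (1 - x * Num.conj y).
  have := cnorm_sub_ge 1 (x * Num.conj y); rewrite cnorm1 cnormM cnorm_Cconj.
  have : N x * N y <= N x by rewrite ler_piMr ?cnorm_ge0// ltW.
  by move: dx; lra.
have := cnorm_ge0 (g x - g y); have := cnorm_ge0 (x - y).
move: (N _) (N (x - y)) (N (1 - _)) (N (1 - _)) => a b u v b0 a0 dv u2 h.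
rewrite mulrAC ler_pdivlMr//.
have : a * d <= a * v by rewrite ler_wpM2l.
have : u * b <= 2 * b by rewrite ler_wpM2r.
by move: h; lra.
Qed.

(** The Schur transform of g at x: a Moebius map applied to g, divided by the Blaschke factor at x.
    At y = x the formula gives 0 rather than a limit, so x has to join the exceptional set. *)
Definition schurT g x y : R[i] :=
  (g y - g x) / (1 - Num.conj (g x) * g y) * ((1 - Num.conj x * y) / (y - x)).

Lemma pickS1 g x y w :
  pickS g [tuple x] y w = pickK g y w - pickK g y x * pickK g x w / pickK g x x.
Proof.
rewrite /pickS; congr (_ - _).
have -> : kernel_mx (pickK g) [tuple x] = (pickK g x x)%:M.
  by apply/matrixP => i j; rewrite !ord1 !mxE eqxx mulr1n.
rewrite invmx_scalar mul_mx_scalar -scalemxAl !mxE big_ord_recl big_ord0 !mxE.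
by rewrite pickK_conj addr0 mulrC.
Qed.

Lemma mobius_neq0 g x y : N (g x) < 1 -> N (g y) <= 1 -> 1 - Num.conj (g x) * g y != 0.
Proof.
move=> gx gy; rewrite -cnorm_gt0.
have := cnorm_sub_ge 1 (Num.conj (g x) * g y); rewrite cnorm1 cnormM cnorm_Cconj.
have : N (g x) * N (g y) <= N (g x) by rewrite ler_piMr ?cnorm_ge0.
by move: gx; lra.
Qed.

(** For a single point the Schur complement is computed directly: up to congruence it is the Pick
    kernel of the Schur transform. *)
Lemma pickS_schurT g x y w : N x < 1 -> N y < 1 -> N w < 1 ->
  N (g x) < 1 -> N (g y) <= 1 -> N (g w) <= 1 -> y != x -> w != x ->
  let c u := (1 - Num.conj (g x) * g u) * ((u - x) / (1 - Num.conj x * u)) in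
  pickS g [tuple x] y w = ((1 - N (g x) ^+ 2)^-1)%:C%C *
    c y * pickK (schurT g x) y w * Num.conj (c w).
Proof.
move=> x1 y1 w1 gx gy gw yx wx c.
have cy := mobius_neq0 gx gy; have cw := mobius_neq0 gx gw.
have xy : 1 - Num.conj x * y != 0 by rewrite mulrC disk_neq0 ?diskE.
have xw : 1 - Num.conj x * w != 0 by rewrite mulrC disk_neq0 ?diskE.
have yw : 1 - y * Num.conj w != 0 by rewrite disk_neq0 ?diskE.
have xx : 1 - x * Num.conj x != 0 by rewrite disk_neq0 ?diskE.
have gg : 1 - g x * Num.conj (g x) != 0.
  rewrite mulr_cconj -(rmorph1 (real_complex R)) -rmorphB /= -cnorm_gt0.
  by rewrite cnorm_real normr_gt0 lt0r_neq0// sqr_lt1.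
have -> : ((1 - N (g x) ^+ 2)^-1)%:C%C = (1 - g x * Num.conj (g x))^-1.
  by rewrite fmorphV rmorphB rmorph1 /= mulr_cconj.
have cw' : 1 - g x * Num.conj (g w) != 0.
  by move: cw; rewrite -conjC_eq0 rmorphB rmorphM rmorph1 /= conjCK.
have xw' : 1 - x * Num.conj w != 0.
  by move: xw; rewrite -conjC_eq0 rmorphB rmorphM rmorph1 /= conjCK.
have wx' : Num.conj w - Num.conj x != 0.
  by rewrite -rmorphB conjC_eq0 subr_eq0.
have yx' : y - x != 0 by rewrite subr_eq0.
rewrite pickS1 /pickK /schurT /c !(rmorphM, rmorphB, fmorphV, rmorph1) /= !conjCK.
field.
by rewrite ?cy ?cw' ?xy ?xw' ?yw ?xx ?gg ?wx' ?yx'; rewrite ?[y * Num.conj x]mulrC ?xy.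
Qed.

End Pair.

(** * Regularity from three-point positivity *)

Section Hindmarsh.
Variable R : realType.
Local Notation N := (@cnorm R).
Implicit Types (f g : R[i] -> R[i]) (x y z w : R[i]) (L E : set R[i]).

Lemma psd_single_unit g x : N x < 1 -> N (g x) < 1 ->
  kernel_mx (pickK g) [tuple x] \in unitmx.
Proof.
move=> x1 gx; have -> : kernel_mx (pickK g) [tuple x] = (pickK g x x)%:M.
  by apply/matrixP => i j; rewrite !ord1 !mxE eqxx mulr1n.
rewrite unitmxE det_scalar expr1 unitfE pickK_diag -cnorm_gt0 cnorm_real normr_gt0.
by rewrite mulf_neq0 ?invr_eq0 ?lt0r_neq0// sqr_lt1.
Qed.

(** One step of the Schur algorithm: a point is traded for a transform. The pivot is positive
    because |g x| < 1. *)
Lemma psd_schurT g n x (y : n.-tuple R[i]) : N x < 1 -> N (g x) < 1 ->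
  (forall i, N (tnth y i) < 1) -> (forall i, N (g (tnth y i)) <= 1) -> x \notin y ->
  psd (kernel_mx (pickK g) [tuple of [tuple x] ++ y]) <->
  psd (kernel_mx (pickK (schurT g x)) y).
Proof.
move=> x1 gx y1 gy xy.
have yx i : tnth y i != x by apply: contraNneq xy => <-; apply: mem_tnth.
have g1 : 0 < (1 - N (g x) ^+ 2)^-1 by rewrite invr_gt0 sqr_lt1.
have u := psd_single_unit x1 gx.
have h1 : (kernel_mx (pickK g) [tuple x])^t* = kernel_mx (pickK g) [tuple x].
  by apply: kernel_mx_herm; apply: pickK_conj.
pose c v := (1 - Num.conj (g x) * g v) * ((v - x) / (1 - Num.conj x * v)).
have hS i j : pickS g [tuple x] (tnth y i) (tnth y j) =
    ((1 - N (g x) ^+ 2)^-1)%:C%C * c (tnth y i) *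
    pickK (schurT g x) (tnth y i) (tnth y j) * Num.conj (c (tnth y j)).
  exact: pickS_schurT.
rewrite pick_cat; split.
  move=> /(psd_schur h1 u); rewrite pick_schurE.
  apply: psd_kernel_congrV hS; first by rewrite -[0]/(0%:C%C) ltcR.
  move=> i; rewrite !mulf_neq0 ?mobius_neq0 ?subr_eq0 ?yx ?invr_eq0//.
  by rewrite mulrC disk_neq0 ?diskE.
move=> hT; apply: (psd_block h1 u).
  move=> v; rewrite qform_kernel !big_ord_recl !big_ord0 !addr0 pickK_diag.
  rewrite mulrAC -normCK mulr_ge0 ?exprn_ge0// -[0]/(0%:C%C) lecR.
  by rewrite divr_ge0// ltW// sqr_lt1.
rewrite pick_schurE; apply: psd_kernel_congr hS hT.
by rewrite -[0]/(0%:C%C) lecR ltW.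
Qed.

(* Three-point positivity makes the Schur transform at every point
   Lipschitz, i.e. it controls the difference quotients of [f]. *)
Lemma psd3_C11 f L : sparse L ->
  (forall n (z : n.-tuple R[i]), (n <= 3)%N -> uniq z ->
     (forall i, N (tnth z i) < 1 /\ ~ L (tnth z i)) -> psd (kernel_mx (pickK f) z)) ->
  forall z, N z < 1 -> ~ L z -> C11 f z.
Proof.
move=> hL hp z z1 Lz.
have [r0 r00 hr0] := sparse_ball hL z1 Lz.
have [d d0 dE] : exists2 d, 0 < d & 1 - N z = 2 * d.
  by exists ((1 - N z) / 2); [lra|field].
pose r := Num.min r0 d; have rp : 0 < r by rewrite lt_min r00.
have hr x : N (x - z) < r -> [/\ N x < 1, ~ L x & d <= 1 - N x].
  rewrite lt_min => /andP[/hr0 Lx xd]; have := cnorm_sub_ge x z.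
  by split=> //; lra.
have h1 x : N (x - z) < r -> N (f x) <= 1.
  move=> /hr[x1 Lx _]; apply: psd1_le1 => //; apply: hp => // i.
  by rewrite !ord1 /tnth /=.
have h2 x y : N (x - z) < r -> N (y - z) < r -> x != y ->
    psd (kernel_mx (pickK f) [tuple x; y]).
  move=> /hr[x1 Lx _] /hr[y1 Ly _] xy; apply: hp => //=; first by rewrite inE xy.
  by case=> -[|[|[]]]//= i; rewrite /tnth.
have lip x y : N (x - z) < r -> N (y - z) < r -> N (f y - f x) <= 2 / d * N (y - x).
  move=> hx hy; have [->|xy] := eqVneq x y; first by rewrite !subrr cnorm0 mulr0.
  have [x1 _ dx] := hr x hx; have [y1 _ _] := hr y hy.
  exact: psd2_lipschitz (h2 _ _ hx hy xy).
(* The summands bound |f|, the Lipschitz constant of f, and the second differences; the last group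
   comes from the variation of [G] and of [m] below. *)
pose M := 1 + 2 / d + ((2 / d) ^+ 2 + (2 + 2 * (2 / d)) / d ^+ 2).
have D0 : 0 <= 2 / d by rewrite divr_ge0// ltW.
have D1 : 0 <= (2 + 2 * (2 / d)) / d ^+ 2.
  have dge0 := ltW d0; apply: divr_ge0; last exact: exprn_ge0.
  by apply: addr_ge0 => //; apply: mulr_ge0.
have D2 : 0 <= (2 / d) ^+ 2 by rewrite exprn_ge0.
exists r, M; split => //; first by rewrite /M; lra.
move=> x y w hx hy hw.
have [x1 Lx dx] := hr x hx; have [y1 Ly dy] := hr y hy; have [w1 Lw dw] := hr w hw.
split.
- by have := h1 x hx; rewrite /M; lra.
- apply: le_trans (lip x y hx hy) _; rewrite ler_wpM2r ?cnorm_ge0// /M; lra.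
have M0 : 0 <= M by rewrite /M; lra.
have rhs0 : 0 <= M * (N (y - w) * N (y - x) * N (w - x)).
  by rewrite !mulr_ge0 ?cnorm_ge0.
have [->|yx] := eqVneq y x; first by rewrite !subrr mulr0 mul0r subrr cnorm0 mulr0 mul0r mulr0.
have [->|wx] := eqVneq w x; first by rewrite !subrr mulr0 mul0r subrr cnorm0 !mulr0.
have [->|yw] := eqVneq y w; first by rewrite !subrr cnorm0 !mul0r mulr0.
(* When |f x| = 1 there is no Schur transform, but Schwarz-Pick then forces f to be constant near
   z. *)
have [fx|fx] := ltP (N (f x)) 1; last first.
  have {}fx : N (f x) = 1 by apply/eqP; rewrite eq_le fx h1.
  suff e v : N (v - z) < r -> v != x -> f v = f x.
    by rewrite !e// !subrr !mul0r subrr cnorm0.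
  move=> hv vx; have [v1 _ _] := hr v hv.
  rewrite eq_sym in vx; have := psd2_contraction x1 v1 (h2 _ _ hx hv vx).
  have := cnorm_blaschke (f x) (f v); rewrite fx expr1n subrr mul0r => /eqP.
  rewrite subr_eq0 eqrXn2 ?cnorm_ge0// => /eqP ->.
  have := cnorm_blaschke x v; have := mulr_gt0 (sqr_lt1 x1) (sqr_lt1 v1).
  move=> h e; have lt : N (x - v) < N (1 - x * Num.conj v).
    by rewrite -(ltr_pXn2r (n := 2)) ?nnegrE ?cnorm_ge0// -subr_gt0 e.
  have [/eqP|n0] := eqVneq (N (f x - f v)) 0.
    by rewrite cnorm_eq0 subr_eq0 => /eqP.
  by rewrite ler_pM2l ?lt_def ?n0 ?cnorm_ge0// leNgt lt.
pose G := schurT f x.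
have hG : psd (kernel_mx (pickK G) [tuple y; w]).
  have H1 (i : 'I_2) : N (tnth [tuple y; w] i) < 1.
    by case: i => -[|[|[]]]// i; rewrite /tnth.
  have H2 (i : 'I_2) : N (f (tnth [tuple y; w] i)) <= 1.
    by case: i => -[|[|[]]]// i; rewrite /tnth /= h1.
  have H3 : x \notin [tuple y; w].
    by rewrite !inE negb_or ![x == _]eq_sym yx.
  have [hT _] := psd_schurT x1 fx H1 H2 H3; apply: hT.
  have H4 : uniq [tuple of [tuple x] ++ [tuple y; w]].
    by rewrite /= !inE negb_or ![x == _]eq_sym yx wx yw.
  apply: (hp _ _ _ H4) => // i.
  case: i => -[|[|[|[]]]]// i; rewrite /tnth /=; by split.
have GL := psd2_lipschitz y1 w1 d0 dy hG.
have Gw : N (G w) <= 1.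
  by apply: psd1_le1 => //; apply: psd_subset hG => u; rewrite !inE => ->; rewrite orbT.
(* Solving for f gives the difference quotient at x as [G v * m v], a product of two bounded
   Lipschitz functions. *)
pose m v := (1 - Num.conj (f x) * f v) / (1 - Num.conj x * v).
have nz v : N v < 1 -> 1 - Num.conj x * v != 0.
  by move=> v1; rewrite mulrC disk_neq0 ?diskE.
have dn v : N v < 1 -> d <= N (1 - Num.conj x * v).
  move=> v1; have := cnorm_sub_ge 1 (Num.conj x * v); rewrite cnorm1 cnormM cnorm_Cconj.
  have : N x * N v <= N x by rewrite ler_piMr ?cnorm_ge0// ltW.
  by move: dx; lra.
have num v : N (v - z) < r -> N (1 - Num.conj (f x) * f v) <= 2.
  move=> hv; apply: le_trans (cnormB _ _) _; rewrite cnorm1 cnormM cnorm_Cconj.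
  by have := mulr_ile1 (cnorm_ge0 _) (cnorm_ge0 _) (h1 x hx) (h1 v hv); lra.
have fG v : N (v - z) < r -> v != x -> N v < 1 -> f v - f x = G v * m v * (v - x).
  move=> hv vx v1; rewrite /G /schurT /m; field.
  by rewrite mobius_neq0 ?h1// nz// subr_eq0 vx.
rewrite (fG y)// (fG w)//.
have -> : G y * m y * (y - x) * (w - x) - G w * m w * (w - x) * (y - x) =
   ((G y - G w) * m y + G w * (m y - m w)) * (y - x) * (w - x) by ring.
have -> : M * (N (y - w) * N (y - x) * N (w - x)) =
  M * N (y - w) * N (y - x) * N (w - x) by ring.
rewrite 2!cnormM ler_wpM2r ?cnorm_ge0// ler_wpM2r ?cnorm_ge0//.
have mE : m y - m w = ((1 - Num.conj (f x) * f y) * Num.conj x * (y - w) +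
   (1 - Num.conj x * y) * Num.conj (f x) * (f w - f y)) /
   ((1 - Num.conj x * y) * (1 - Num.conj x * w)).
  by rewrite /m; field; rewrite !nz.
have my : N (m y) <= 2 / d.
  rewrite /m cnormM cnormV ler_pM ?invr_ge0 ?cnorm_ge0 ?num//.
  by rewrite lef_pV2 ?posrE ?(lt_le_trans d0) ?dn.
have mL : N (m y - m w) <= (2 + 2 * (2 / d)) / d ^+ 2 * N (y - w).
  rewrite mE cnormM cnormV [leRHS]mulrAC ler_pM ?invr_ge0 ?cnorm_ge0//.
    apply: le_trans (cnormD _ _) _; rewrite [leRHS]mulrDl !cnormM !cnorm_Cconj lerD//.
      rewrite ler_wpM2r ?cnorm_ge0//.
      have := num y hy; have := cnorm_ge0 (1 - Num.conj (f x) * f y).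
      have := cnorm_ge0 x; move: x1; nra.
    rewrite -[leRHS]mulrA ler_pM ?mulr_ge0 ?cnorm_ge0//.
      have := cnormB 1 (Num.conj x * y); rewrite cnorm1 cnormM cnorm_Cconj.
      have := mulr_ile1 (cnorm_ge0 x) (cnorm_ge0 y) (ltW x1) (ltW y1).
      have : N (1 - Num.conj x * y) * N (f x) <= N (1 - Num.conj x * y).
        by rewrite ler_piMr ?cnorm_ge0// h1.
      lra.
    by rewrite (cnorm_distC y); apply: lip.
  rewrite lef_pV2 ?posrE ?exprn_gt0 ?cnorm_gt0 ?mulf_neq0 ?nz//.
  by rewrite cnormM expr2 ler_pM ?dn// ltW.
apply: le_trans (cnormD _ _) _; rewrite (cnormM (G y - G w)) (cnormM (G w)).
have e1 : N (G y - G w) * N (m y) <= (2 / d) ^+ 2 * N (y - w).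
  rewrite expr2 mulrAC ler_pM ?cnorm_ge0//.
  by move: GL; rewrite (cnorm_distC w) (cnorm_distC (G w)).
have e2 : N (G w) * N (m y - m w) <= (2 + 2 * (2 / d)) / d ^+ 2 * N (y - w).
  by apply: le_trans mL; rewrite ler_piMl ?cnorm_ge0.
have e3 : 0 <= (1 + 2 / d) * N (y - w).
  by rewrite mulr_ge0 ?cnorm_ge0// addr_ge0.
apply: le_trans (lerD e1 e2) _.
by rewrite /M [leRHS]mulrDl [X in _ <= _ + X]mulrDl lerDr.
Qed.

End Hindmarsh.

(** * Contractive functions have positive Pick matrices *)

Section SchurClass.
Variable R : realType.
Local Notation N := (@cnorm R).
Implicit Types (f g : R[i] -> R[i]) (x y z w : R[i]) (L E : set R[i]).

Lemma LipM f g z : Lip f z -> Lip g z -> Lip (fun x => f x * g x) z.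
Proof.
move=> [r [M [r0 M0 hM]]] [s [K [s0 K0 hK]]].
have c0 : 0 <= N (g z) + K * s by rewrite addr_ge0 ?cnorm_ge0// mulr_ge0// ltW.
exists (Num.min r s), (M * (N (g z) + K * s) + N (f z) * K); split.
- by rewrite lt_min r0.
- by rewrite addr_ge0 ?mulr_ge0 ?cnorm_ge0.
move=> x; rewrite lt_min => /andP[/hM h1 xs]; have h2 := hK x xs.
have -> : f x * g x - f z * g z = (f x - f z) * g x + f z * (g x - g z) by ring.
apply: le_trans (cnormD _ _) _; rewrite !cnormM [leRHS]mulrDl lerD//.
  rewrite [leRHS]mulrAC ler_pM ?cnorm_ge0//.
  have := cnorm_sub_ge (g x) (g z).
  have : K * N (x - z) <= K * s by rewrite ler_wpM2l// ltW.
  by move: h2; lra.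
by rewrite -mulrA ler_wpM2l ?cnorm_ge0.
Qed.

Lemma schurT_C11 g x y : N x < 1 -> N (g x) < 1 -> N (g y) <= 1 -> y != x ->
  C11 g y -> C11 (schurT g x) y.
Proof.
move=> x1 gx gy yx hg; have cst c := @C11_cst R c y; have id := @C11_id R y.
apply: C11M; apply: C11_div; rewrite ?mobius_neq0 ?subr_eq0//;
  by apply: C11B => //; apply: C11M.
Qed.

(** The bound t < 1 keeps the Moebius denominator at least 1 - t near y, so the Moebius map
    preserves a pointwise Lipschitz bound; the other factor is smooth off x. *)
Lemma schurT_Lip g x y (t : R) : N x < 1 -> t < 1 -> N (g x) <= t -> y != x ->
  (exists2 r : R, 0 < r & forall v, N (v - y) < r -> N (g v) <= t) ->
  Lip g y -> Lip (schurT g x) y.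
Proof.
move=> x1 t1 gx yx [s s0 hs] [r [M [r0 M0 hM]]]; apply: LipM; last first.
  have cst c := @C11_cst R c y; have id := @C11_id R y.
  apply: C11_Lip; apply: C11_div; rewrite ?subr_eq0//;
  by apply: C11B => //; apply: C11M.
have tp : 0 < 1 - t by lra.
have den v : N (v - y) < s -> 1 - t <= N (1 - Num.conj (g x) * g v).
  move=> /hs gv; have := cnorm_sub_ge 1 (Num.conj (g x) * g v).
  rewrite cnorm1 cnormM cnorm_Cconj.
  have : N (g x) * N (g v) <= N (g x).
    by rewrite ler_piMr ?cnorm_ge0//; move: gv t1; lra.
  by move: gx; lra.
have nz v : N (v - y) < s -> 1 - Num.conj (g x) * g v != 0.
  by move=> /den; rewrite -cnorm_gt0; lra.
exists (Num.min r s), (M * (2 / (1 - t) ^+ 2)); split.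
- by rewrite lt_min r0.
- by rewrite mulr_ge0// divr_ge0// exprn_ge0// ltW.
move=> v; rewrite lt_min => /andP[/hM h vs].
have ys : N (y - y) < s by rewrite subrr cnorm0.
have -> : (g v - g x) / (1 - Num.conj (g x) * g v) -
   (g y - g x) / (1 - Num.conj (g x) * g y) =
   (g v - g y) * ((1 - g x * Num.conj (g x)) /
     ((1 - Num.conj (g x) * g v) * (1 - Num.conj (g x) * g y))).
  by field; rewrite !nz.
rewrite cnormM [leRHS]mulrAC ler_pM ?cnorm_ge0// cnormM cnormV.
rewrite ler_pM ?invr_ge0 ?cnorm_ge0//.
  apply: le_trans (cnormB _ _) _; rewrite cnorm1 cnormM cnorm_Cconj.
  have gx1 : N (g x) <= 1 by lra.
  by have := mulr_ile1 (cnorm_ge0 _) (cnorm_ge0 _) gx1 gx1; lra.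
rewrite lef_pV2 ?posrE ?exprn_gt0 ?cnorm_gt0 ?mulf_neq0 ?nz//.
by rewrite cnormM expr2 ler_pM ?den// ltW.
Qed.

(** A Schwarz lemma. The Moebius factor is at most 1, the inverse Blaschke factor tends to modulus 1
    at the unit circle, and the Lipschitz bound at x controls the quotient near x, so [bounded_max]
    applies off [E] and x. *)
Lemma schurT_le1 g x E (t : R) : sparse E -> N x < 1 -> 0 <= t -> t < 1 ->
  N (g x) <= t -> (forall y, N y < 1 -> ~ E y -> N (g y) <= t) ->
  (forall y, N y < 1 -> ~ E y -> C11 g y) -> Lip g x ->
  forall y, N y < 1 -> ~ E y -> y != x -> N (schurT g x y) <= 1.
Proof.
move=> hE x1 t0 t1 gx gt gC [r [M [r0 M0 hM]]].
have tp : 0 < 1 - t by lra.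
have den v : N (g v) <= t -> 1 - t <= N (1 - Num.conj (g x) * g v).
  move=> gv; have := cnorm_sub_ge 1 (Num.conj (g x) * g v).
  rewrite cnorm1 cnormM cnorm_Cconj.
  have : N (g x) * N (g v) <= N (g x).
    by rewrite ler_piMr ?cnorm_ge0//; move: gv t1; lra.
  by move: gx; lra.
have num y : N y < 1 -> N (1 - Num.conj x * y) <= 2.
  move=> y1; apply: le_trans (cnormB _ _) _; rewrite cnorm1 cnormM cnorm_Cconj.
  by have := mulr_ile1 (cnorm_ge0 _) (cnorm_ge0 _) (ltW x1) (ltW y1); lra.
have mob y : N (g y) <= t -> N ((g y - g x) / (1 - Num.conj (g x) * g y)) <= 1.
  move=> gy; have d := den y gy.
  rewrite cnormM cnormV ler_pdivrMr ?(lt_le_trans tp)// mul1r.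
  rewrite -(ler_pXn2r (n := 2)) ?nnegrE ?cnorm_ge0// -subr_ge0.
  rewrite [Num.conj _ * _]mulrC cnorm_blaschke mulr_ge0// subr_ge0.
    by rewrite expr_le1 ?cnorm_ge0//; lra.
  by rewrite expr_le1 ?cnorm_ge0//; lra.
suff H : forall y, N y < 1 -> ~ (E `|` [set x]) y -> N (schurT g x y) <= 1.
  by move=> y y1 Ey yx; apply: H => // -[//|/= /eqP]; apply/negP.
have nE y : ~ (E `|` [set x]) y -> ~ E y /\ y != x.
  by move=> h; split=> [Ey|]; [apply: h; left|apply/eqP => yx; apply: h; right].
(* The first bound holds at distance at least r from x, the second one closer to x. *)
apply: (@bounded_max R (E `|` [set x]) _ (Num.max (2 / r) (2 * (M / (1 - t))))).
- exact: sparseU1.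
- move=> y y1 /nE[Ey yx]; apply: schurT_C11 => //; last exact: gC.
    by lra.
  by have := gt y y1 Ey; lra.
- move=> y y1 /nE[Ey yx]; have gy := gt y y1 Ey.
  have dp : 0 < N (y - x) by rewrite cnorm_gt0 subr_eq0.
  rewrite le_max; apply/orP; have [yr|yr] := ltP (N (y - x)) r.
    right; have h := hM y yr; rewrite /schurT !cnormM !cnormV.
    have -> : N (g y - g x) / N (1 - Num.conj (g x) * g y) *
        (N (1 - Num.conj x * y) / N (y - x)) =
        N (1 - Num.conj x * y) *
        ((N (g y - g x) / N (y - x)) / N (1 - Num.conj (g x) * g y)) by ring.
    rewrite ler_pM ?mulr_ge0 ?invr_ge0 ?cnorm_ge0 ?num//.
    rewrite ler_pM ?mulr_ge0 ?invr_ge0 ?cnorm_ge0//.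
      by rewrite ler_pdivrMr.
    by rewrite lef_pV2 ?posrE ?den// (lt_le_trans tp)// den.
  left; rewrite /schurT cnormM -[leRHS]mul1r ler_pM ?cnorm_ge0 ?mob//.
  rewrite cnormM cnormV ler_pM ?invr_ge0 ?cnorm_ge0 ?num//.
  by rewrite lef_pV2 ?posrE.
- move=> d d0.
  have [c c0 cE] : exists2 c, 0 < c & 1 - N x = 2 * c.
    by exists ((1 - N x) / 2); [lra|field].
  have dc : 0 < d * c ^+ 2 by rewrite mulr_gt0// exprn_gt0.
  (* The first radius gives |y - x| >= c; the second makes the excess in [cnorm_blaschke] at most 2
     d c^2, hence at most 2 d |y - x|^2. *)
  exists (Num.max (1 - c) (1 - d * c ^+ 2)).
    by rewrite gt_max !ltrBlDr !ltrDl c0 dc.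
  move=> y; rewrite ge_max => /andP[yc yd] y1 /nE[Ey yx].
  rewrite /schurT cnormM -[leRHS]mul1r ler_pM ?cnorm_ge0 ?mob ?gt//.
  have dp : 0 < N (y - x) by rewrite cnorm_gt0 subr_eq0.
  rewrite cnormM cnormV ler_pdivrMr//.
  rewrite -(ler_pXn2r (n := 2)) ?nnegrE ?mulr_ge0 ?cnorm_ge0//; last by lra.
  have := cnorm_blaschke y x; rewrite [y * _]mulrC => e.
  have cyx : c <= N (y - x) by have := cnorm_sub_ge y x; lra.
  have c2 : c ^+ 2 <= N (y - x) ^+ 2 by rewrite lerXn2r ?nnegrE ?cnorm_ge0// ltW.
  have x2 : 0 <= N x ^+ 2 by rewrite exprn_ge0 ?cnorm_ge0.
  have y2 := sqr_lt1 y1.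
  have e1 : (1 - N y ^+ 2) * (1 - N x ^+ 2) <= 1 - N y ^+ 2.
    by have y2' := ltW y2; rewrite ler_piMr//; lra.
  have e2 : 1 - N y ^+ 2 <= 2 * (1 - N y) by have := cnorm_ge0 y; nra.
  have e3 : d * c ^+ 2 <= d * N (y - x) ^+ 2 by rewrite ler_wpM2l// ltW.
  rewrite exprMn.
  have e4 : 0 <= d ^+ 2 * N (y - x) ^+ 2 by rewrite mulr_ge0 ?exprn_ge0 ?cnorm_ge0// ltW.
  have -> : (1 + d) ^+ 2 * N (y - x) ^+ 2 =
    N (y - x) ^+ 2 + 2 * (d * N (y - x) ^+ 2) + d ^+ 2 * N (y - x) ^+ 2 by ring.
  by lra.
Qed.

(** The bound extends to a point of [E] by comparison with points y + u off [E], for small real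
    u. *)
Lemma Lip_le1 f E y : sparse E -> N y < 1 -> Lip f y ->
  (forall v, N v < 1 -> ~ E v -> N (f v) <= 1) -> N (f y) <= 1.
Proof.
move=> hE y1 [r [M [r0 M0 hM]]] f1.
rewrite leNgt; apply/negP => fy.
have [s s0 hs] := hE y y1.
have M1 : 0 < M + 1 by lra.
have [q q0 qE] : exists2 q, 0 < q & q * (M + 1) = N (f y) - 1.
  exists ((N (f y) - 1) / (M + 1)); first by rewrite divr_gt0// subr_gt0.
  by rewrite divfK// lt0r_neq0.
have [a [a0 ar as_ ay aq]] : exists a, [/\ 0 < a, a <= r, a <= s, a <= 1 - N y & a <= q].
  exists (Num.min (Num.min r s) (Num.min (1 - N y) q)).
  by rewrite !lt_min r0 s0 subr_gt0 y1 q0 !ge_min !lexx !orbT.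
have [u [u0 ur us uy uM]] :
    exists u, [/\ 0 < u, u < r, u < s, u < 1 - N y & u * (M + 1) < N (f y) - 1].
  by exists (a / 2); rewrite -qE ltr_pM2r//; split; lra.
pose v := y + u%:C%C.
have vy : N (v - y) = u by rewrite /v addrC addKr cnorm_real gtr0_norm.
have vny : v != y by rewrite -subr_eq0 -cnorm_eq0 vy lt0r_neq0.
have v1 : N v < 1 by have := cnorm_sub_ge v y; rewrite vy; lra.
have Ev : ~ E v by move=> Ev; have := hs v Ev vny; rewrite vy; lra.
have := f1 v v1 Ev; have := hM v; rewrite vy => /(_ ur).
have := cnorm_sub_ge (f y) (f v); rewrite cnorm_distC.
by move: uM; lra.
Qed.

(** The Pick kernel of s g is a convex combination of that of g and the Szego kernel, the Pick
    kernel of 0; this lets s tend to 1. *)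
Lemma qform_pick_scale g (s : R) n (z : n.-tuple R[i]) v :
  qform (kernel_mx (pickK (fun x => s%:C%C * g x)) z) v =
  (s ^+ 2)%:C%C * qform (kernel_mx (pickK g) z) v +
  (1 - s ^+ 2)%:C%C * qform (kernel_mx (pickK (fun=> 0)) z) v.
Proof.
rewrite !qform_kernel !mulr_sumr -big_split; apply: eq_bigr => i _ /=.
rewrite !mulr_sumr -big_split; apply: eq_bigr => j _ /=.
have cs : Num.conj (s%:C%C : R[i]) = s%:C%C.
  by apply/CrealP; rewrite complex_real.
rewrite /pickK rmorphM rmorphB rmorphXn rmorph1 /= cs; ring.
Qed.

(** The Schur algorithm, by induction on the number of points: scale to a strict contraction, then
    transform at the first point, which joins both [L] and [E]. The two sets differ because at
    points of [E] outside [L] only the Lipschitz bound is available. *)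
Lemma contractive_psd n : forall g L E, sparse E -> L `<=` E ->
  (forall x, N x < 1 -> ~ L x -> N (g x) <= 1) ->
  (forall x, N x < 1 -> ~ L x -> Lip g x) ->
  (forall x, N x < 1 -> ~ E x -> C11 g x) ->
  forall z : n.-tuple R[i], uniq z ->
  (forall i, N (tnth z i) < 1 /\ ~ L (tnth z i)) -> psd (kernel_mx (pickK g) z).
Proof.
elim: n => [|n IH] g L E hE LE g1 gL gC z uz zD v.
  by rewrite qform_kernel big_ord0.
have sL : sparse L.
  move=> w /hE[r r0 hr]; exists r => // l /LE; exact: hr.
(* strict contractions [s g] first, then [s --> 1] *)
have strict (s : R) : 0 < s -> s < 1 ->
    0 <= qform (kernel_mx (pickK (fun x => s%:C%C * g x)) z) v.
  move=> s0 s1; pose h x := s%:C%C * g x; rewrite -/h.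
  have nh x : N (h x) = s * N (g x) by rewrite cnormM cnorm_real gtr0_norm.
  have ht x : N x < 1 -> ~ L x -> N (h x) <= s.
    by move=> x1 Lx; have s0' := ltW s0; rewrite nh ler_piMr// g1.
  have hC x : N x < 1 -> ~ E x -> C11 h x.
    by move=> x1 Ex; apply: C11M; [apply: C11_cst|apply: gC].
  have hL x : N x < 1 -> ~ L x -> Lip h x.
    move=> x1 Lx; apply: LipM; last exact: gL.
    by apply: C11_Lip; apply: C11_cst.
  case/tupleP: z uz zD v => x y.
  rewrite /= => /andP[xy uy] zD.
  have [x1 Lx] := zD ord0; rewrite tnth0 in x1 Lx.
  have {}zD i : N (tnth y i) < 1 /\ ~ L (tnth y i).
    by have := zD (lift ord0 i); rewrite tnthS.
  suff : psd (kernel_mx (pickK h) [tuple of [tuple x] ++ y]).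
    have -> : kernel_mx (pickK h) [tuple of [tuple x] ++ y] =
       kernel_mx (pickK h) [tuple of x :: y] by apply/matrixP => i j; rewrite !mxE !(tnth_nth 0).
    by apply.
  have hx1 := ht x x1 Lx; have hxs := le_lt_trans hx1 s1.
  apply/(psd_schurT x1 hxs) => //.
  - by move=> i; have [] := zD i.
  - by move=> i; have [yi Li] := zD i; apply: le_trans (ht _ yi Li) (ltW s1).
  have sE' : sparse (E `|` [set x]) by apply: sparseU1.
  have nE w' : ~ (E `|` [set x]) w' -> ~ E w' /\ w' != x.
    by move=> k; split=> [Ey|]; [apply: k; left|apply/eqP => yx; apply: k; right].
  have nL w' : ~ (L `|` [set x]) w' -> ~ L w' /\ w' != x.
    by move=> k; split=> [Ey|]; [apply: k; left|apply/eqP => yx; apply: k; right].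
  have GE w' : N w' < 1 -> ~ (E `|` [set x]) w' -> N (schurT h x w') <= 1.
    move=> w1 /nE[Ew wx]; have s0' := ltW s0; apply: (@schurT_le1 h x E s) => //.
      by move=> q q1 Eq; apply: ht => // /LE.
    exact: hL.
  have GL w' : N w' < 1 -> ~ (L `|` [set x]) w' -> Lip (schurT h x) w'.
    move=> w1 /nL[Lw wx]; apply: (@schurT_Lip h x w' s) => //; last exact: hL.
    have [r r0 hr] := sparse_ball sL w1 Lw.
    exists (Num.min r (1 - N w')); first by rewrite lt_min r0 subr_gt0.
    move=> q; rewrite lt_min => /andP[/hr Lq qw]; apply: ht => //.
    by have := cnorm_sub_ge q w'; lra.
  apply: (IH _ (L `|` [set x]) (E `|` [set x])) => //.
  - by move=> w' [/LE|->]; [left|right].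
  (* [GE] gives the bound off the larger exceptional set only; the Lipschitz property extends it to
     the remaining points. *)
  - by move=> w' w1 Lw; apply: (Lip_le1 sE') => //; apply: GL.
  - move=> w' w1 /nE[Ew wx]; apply: schurT_C11 => //; last exact: hC.
    by apply: le_trans (ltW s1); apply: ht => // /LE.
  - move=> i; have [yi Li] := zD i; split => // -[//|/= yx].
    by move: xy; rewrite -yx mem_tnth.
have Ar : qform (kernel_mx (pickK g) z) v \is Num.real.
  by apply: qform_real; apply: kernel_mx_herm; apply: pickK_conj.
have Br : qform (kernel_mx (pickK (fun=> 0)) z) v \is Num.real.
  by apply: qform_real; apply: kernel_mx_herm; apply: pickK_conj.
have sc s s0 s1 := strict s s0 s1.
move: Ar Br sc => /complex_realP[a aE] /complex_realP[b bE] sc.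
rewrite aE -[0]/(0%:C%C) lecR leNgt; apply/negP => a0.
have {}sc (s : R) : 0 < s -> s < 1 -> 0 <= s ^+ 2 * a + (1 - s ^+ 2) * b.
  move=> s0 s1; have := sc s s0 s1; rewrite qform_pick_scale aE bE.
  by rewrite -!rmorphM -rmorphD -[0]/(0%:C%C) lecR.
have bb := ler_norm b; have b0 := normr_ge0 b.
(* At s = 1 - e the combination is at most a + 2 e (|b| - a) = a / 2, which is negative. *)
pose e := - a / (4 * (`|b| - a)).
have D0 : 0 < 4 * (`|b| - a) by lra.
have e0 : 0 < e by rewrite divr_gt0// oppr_gt0.
have e1 : e <= 1 / 4 by rewrite ler_pdivrMr//; lra.
have ba : `|b| - a != 0 by apply: lt0r_neq0; lra.
have eE : e * (`|b| - a) = - a / 4 by rewrite /e; field.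
clearbody e; have := sc (1 - e); rewrite gtrBl => /(_ _ e0).
move=> h; have {}h : 0 <= (1 - e) ^+ 2 * a + (1 - (1 - e) ^+ 2) * b by apply: h; lra.
have : (2 * e - e ^+ 2) * (b - a) <= 2 * (e * (`|b| - a)).
  have ee : 0 <= e ^+ 2 by rewrite exprn_ge0// ltW.
  have ee1 : e ^+ 2 <= e by rewrite expr2 ler_piMl//; lra.
  have p1 : (2 * e - e ^+ 2) * (b - a) <= (2 * e - e ^+ 2) * (`|b| - a).
    by rewrite ler_wpM2l//; lra.
  have p2 : 0 <= e ^+ 2 * (`|b| - a) by rewrite mulr_ge0//; lra.
  by lra.
have hE' : (1 - e) ^+ 2 * a + (1 - (1 - e) ^+ 2) * b = a + (2 * e - e ^+ 2) * (b - a) by ring.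
by rewrite eE; move: h; rewrite hE'; move: (_ * (b - a)) => q; lra.
Qed.

End SchurClass.

(** * Positivity of Schur complements *)

(* The kernel [S], the functions [a], [b] and the constants [al], [be] are those of
   the Schur complement; they are kept abstract so that conversion never unfolds
   the matrix inverse. *)
Section SchurComplement.
Variables (R : realType) (L : set R[i]) (f : R[i] -> R[i]).
Variables (n : nat) (z : n.-tuple R[i]).
Local Notation N := (@cnorm R).
Hypothesis sL : sparse L.
Hypothesis zD : forall i, N (tnth z i) < 1.
Variables (S : R[i] -> R[i] -> R[i]) (a b : R[i] -> R[i]) (al be : 'I_n -> R[i]).
Hypothesis aE : forall y, a y = 1 - (1 - y) * \sum_j pickK f y (tnth z j) * al j.
Hypothesis bE : forall y, b y = f y - (1 - y) * \sum_j pickK f y (tnth z j) * be j.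
Hypothesis SE : forall y w, N y < 1 -> N w < 1 ->
  S y w * (1 - y * Num.conj w) = a y * Num.conj (a w) - b y * Num.conj (b w).
Hypothesis inv1 : forall y, N y < 1 -> y \notin z ->
  1 = a y + (1 - y) * \sum_j
     (a y * Num.conj (al j) - b y * Num.conj (be j)) / (y - tnth z j).
Hypothesis inv2 : forall y, N y < 1 -> y \notin z ->
  f y = b y + (1 - y) * \sum_j
     (a y * Num.conj (al j) - b y * Num.conj (be j)) / (y - tnth z j) * f (tnth z j).

Let Lz := L `|` [set x | x \in z].
Let g y := b y / a y.

Let sLz : sparse Lz. Proof. exact: sparseUseq. Qed.

Let nLz y : ~ Lz y -> y \notin z.
Proof. by move=> h; apply/negP => yz; apply: h; right. Qed.

Hypothesis psd_a : forall y, N y < 1 -> ~ Lz y ->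
  psd (kernel_mx S [tuple y]).

(** Positivity of S y y gives |b y| <= |a y|; a zero of a would thus be a common zero, contradicting
    [inv1]. *)
Let a_neq0 y : N y < 1 -> ~ Lz y -> a y != 0.
Proof.
move=> y1 Ly; have := psd1 (psd_a y1 Ly) => S0.
have : 0 <= S y y * (1 - y * Num.conj y).
  rewrite mulr_ge0// mulr_cconj -(rmorph1 (real_complex R)) -rmorphB.
  by rewrite -[0]/(0%:C%C) lecR ltW// sqr_lt1.
rewrite SE// !mulr_cconj -rmorphB -[0]/(0%:C%C) lecR subr_ge0 => ba.
apply/eqP => a0; rewrite a0 cnorm0 expr0n /= in ba.
have b0 : b y = 0.
  apply/eqP; rewrite -cnorm_eq0 -sqrf_eq0 eq_le ba.
  by rewrite exprn_ge0// cnorm_ge0.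
have := inv1 y1 (nLz Ly) => /eqP.
rewrite a0 b0 big1 ?mulr0 ?addr0 ?oner_eq0// => j _.
by rewrite !mul0r subrr mul0r.
Qed.

Lemma pickS_psd_iff m (y : m.-tuple R[i]) :
  (forall i, N (tnth y i) < 1 /\ ~ Lz (tnth y i)) ->
  psd (kernel_mx S y) <-> psd (kernel_mx (pickK g) y).
Proof.
move=> hy.
have a0 i : a (tnth y i) != 0 by have [? ?] := hy i; apply: a_neq0.
have E i j : S (tnth y i) (tnth y j) = 1 * a (tnth y i) *
    pickK g (tnth y i) (tnth y j) * Num.conj (a (tnth y j)).
  have [yi _] := hy i; have [yj _] := hy j.
  have d : 1 - tnth y i * Num.conj (tnth y j) != 0 by rewrite disk_neq0 ?diskE.
  apply: (mulIf d); rewrite SE//.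
  have ai := a0 i; have := a0 j; rewrite -conjC_eq0 => aj.
  by rewrite /pickK /g rmorphM fmorphV /=; field; rewrite ai aj d.
by split; [apply: psd_kernel_congrV E|apply: psd_kernel_congr E].
Qed.

Lemma J_quotient_le1 y : N y < 1 -> ~ Lz y -> N (g y) <= 1.
Proof.
move=> y1 Ly; apply: (psd1_le1 y1).
have yD (i : 'I_1) : N (tnth [tuple y] i) < 1 /\ ~ Lz (tnth [tuple y] i).
  by rewrite !ord1 /tnth.
exact: (pickS_psd_iff yD).1 (psd_a y1 Ly).
Qed.

Lemma J_quotient_C11 y : N y < 1 -> ~ Lz y -> C11 f y -> C11 g y.
Proof.
move=> y1 Ly fy; have cst c := @C11_cst R c y; have id := @C11_id R y.
have K j : C11 (fun v => pickK f v (tnth z j)) y.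
  apply: C11_div; rewrite ?disk_neq0 ?diskE//; apply: C11B => //; exact: C11M.
have sC (c : 'I_n -> R[i]) : C11 (fun v => (1 - v) * \sum_j pickK f v (tnth z j) * c j) y.
  apply: C11M; first exact: C11B.
  by apply: C11_sum => j; apply: C11M.
apply: C11_div; last exact: a_neq0.
  by apply: (@C11_ext _ (fun v => f v - (1 - v) * \sum_j pickK f v (tnth z j) * be j)
    _ _ 1) => //; apply: C11B.
by apply: (@C11_ext _ (fun v => 1 - (1 - v) * \sum_j pickK f v (tnth z j) * al j)
  _ _ 1) => //; apply: C11B.
Qed.

(** Divided by a, the inversion formulas read 1 / a = [den] and f / a = [num], both built from g
    alone, so f = [num / den]. *)
Lemma J_quotient_C11_inv y : N y < 1 -> ~ Lz y -> C11 g y -> C11 f y.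
Proof.
move=> y1 Ly gy; have cst c := @C11_cst R c y; have id := @C11_id R y.
pose m j v := (Num.conj (al j) - g v * Num.conj (be j)) / (v - tnth z j).
pose den v := 1 + (1 - v) * \sum_j m j v.
pose num v := g v + (1 - v) * \sum_j m j v * f (tnth z j).
have mE v j : a v != 0 -> (a v * Num.conj (al j) -
    b v * Num.conj (be j)) / (v - tnth z j) = a v * m j v.
  move=> av; rewrite /m mulrA mulrBr; congr ((_ - _) / _).
  by rewrite /g; field.
have denE v : N v < 1 -> ~ Lz v -> a v * den v = 1.
  move=> v1 Lv; have av := a_neq0 v1 Lv.
  rewrite [RHS](inv1 v1 (nLz Lv)) /den mulrDr mulr1 mulrCA; congr (_ + _ * _).
  by rewrite mulr_sumr; apply: eq_bigr => j _; rewrite mE.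
have numE v : N v < 1 -> ~ Lz v -> f v = num v / den v.
  move=> v1 Lv; have av := a_neq0 v1 Lv; have dE := denE v v1 Lv.
  have dv : den v != 0.
    apply: contraTneq isT => d0; move: dE; rewrite d0 mulr0 => /eqP.
    by rewrite eq_sym oner_eq0.
  apply: (mulIf dv); rewrite divfK//; apply: (mulfI av); rewrite mulrCA dE mulr1.
  rewrite (inv2 v1 (nLz Lv)) /num [RHS]mulrDr; congr (_ + _).
    by rewrite /g; field.
  rewrite [RHS]mulrCA; congr (_ * _).
  by rewrite mulr_sumr; apply: eq_bigr => j _; rewrite mE// -[LHS]mulrA.
have [r r0 hr] := sparse_ball sLz y1 Ly.
apply: (@C11_ext _ (fun v => num v / den v) _ _ (Num.min r (1 - N y))).
- by rewrite lt_min r0 subr_gt0.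
- move=> v; rewrite lt_min => /andP[/hr Lv vy]; rewrite numE//.
  by have := cnorm_sub_ge v y; lra.
have mC j : C11 (m j) y.
  apply: C11_div; first by apply: C11B => //; apply: C11M.
    exact: C11B.
  by rewrite subr_eq0; apply: contraNneq (nLz Ly) => ->; apply: mem_tnth.
have cy : C11 (fun v => 1 - v) y by apply: C11B.
apply: C11_div.
- by apply: C11D => //; apply: C11M => //; apply: C11_sum => j; apply: C11M.
- by apply: C11D => //; apply: C11M => //; apply: C11_sum => j.
- apply: contraTneq isT => d0; have := denE y y1 Ly; rewrite d0 mulr0 => /eqP.
  by rewrite eq_sym oner_eq0.
Qed.

Let psd_pickS m := forall y : m.-tuple R[i], uniq y ->
  (forall i, N (tnth y i) < 1 /\ ~ Lz (tnth y i)) -> psd (kernel_mx S y).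

(** Three points suffice because they make g [C11]; [contractive_psd] then applies with equal
    exceptional sets. *)
Lemma pickS_psd3 : (forall m, (m <= 3)%N -> psd_pickS m) ->
  (forall m, psd_pickS m) /\ (forall y, N y < 1 -> ~ Lz y -> C11 f y).
Proof.
move=> H3; have gC y : N y < 1 -> ~ Lz y -> C11 g y.
  apply: (psd3_C11 sLz) => m w m3 uw wD.
  exact: (pickS_psd_iff wD).1 (H3 m m3 w uw wD).
have gp m (y : m.-tuple R[i]) : uniq y ->
    (forall i, N (tnth y i) < 1 /\ ~ Lz (tnth y i)) -> psd (kernel_mx (pickK g) y).
  apply: (@contractive_psd R m g Lz Lz) => //.
    exact: J_quotient_le1.
  by move=> v v1 Lv; apply: C11_Lip; apply: gC.
split; last by move=> y y1 Ly; apply: J_quotient_C11_inv => //; apply: gC.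
by move=> m y uy yD; apply: (pickS_psd_iff yD).2; apply: gp.
Qed.

(** When f is already known to be [C11] off [E], two points suffice: they only have to supply the
    Lipschitz bound on the points of [E] outside [Lz]. *)
Lemma pickS_psd2 E : sparse E -> Lz `<=` E ->
  (forall y, N y < 1 -> ~ E y -> C11 f y) ->
  (forall m, (m <= 2)%N -> psd_pickS m) -> forall m, psd_pickS m.
Proof.
move=> sE LE fC H2 m y uy yD; apply: (pickS_psd_iff yD).2; move: uy yD.
apply: (@contractive_psd R m g Lz E) => //.
- exact: J_quotient_le1.
- move=> v v1 Lv; have [r r0 hr] := sparse_ball sLz v1 Lv.
  have v0 : 0 < 1 - N v by rewrite subr_gt0.
  exists (Num.min r (1 - N v)), (2 / (1 - N v)); split.
  + by rewrite lt_min r0.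
  + by rewrite divr_ge0// ltW.
  + move=> x; rewrite lt_min => /andP[/hr Lx xv].
    have x1 : N x < 1 by have := cnorm_sub_ge x v; lra.
    have [->|xv'] := eqVneq x v; first by rewrite !subrr cnorm0 mulr0.
    have hD (i : 'I_2) : N (tnth [tuple v; x] i) < 1 /\ ~ Lz (tnth [tuple v; x] i).
      by case: i => -[|[|[]]]// i; rewrite /tnth.
    have uvx : uniq [tuple v; x] by rewrite /= inE eq_sym xv'.
    apply: (psd2_lipschitz v1 x1 v0 (lexx _)).
    exact: (pickS_psd_iff hD).1 (H2 2%N isT _ uvx hD).
- by move=> v v1 Ev; apply: J_quotient_C11; [|move=> /LE|apply: fC].
Qed.

End SchurComplement.

(** * Counting negative squares *)

Section NegativeSquares.
Variables (R : realType) (L : set R[i]) (f : R[i] -> R[i]).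
Local Notation N := (@cnorm R).
Local Notation K := (pickK f).
Hypothesis sL : sparse L.

Let D x := N x < 1 /\ ~ L x.

Definition pickS_psd n (z : n.-tuple R[i]) m := forall y : m.-tuple R[i], uniq y ->
  (forall i, D (tnth y i) /\ tnth y i \notin z) -> psd (kernel_mx (pickS f z) y).

Let LzP n (z : n.-tuple R[i]) y :
  (N y < 1 /\ ~ (L `|` [set x | x \in z]) y) <-> (D y /\ y \notin z).
Proof.
split=> [[y1 Ly]|[[y1 Ly] yz]]; last by split => // -[//|/= yz']; rewrite yz' in yz.
by split; [split => // ?; apply: Ly; left|apply/negP => ?; apply: Ly; right].
Qed.

Lemma pickS_psd3_all n (z : n.-tuple R[i]) : (forall i, D (tnth z i)) ->
  kernel_mx K z \in unitmx -> (forall m, (m <= 3)%N -> pickS_psd z m) ->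
  (forall m, pickS_psd z m) /\ (forall y, D y -> y \notin z -> C11 f y).
Proof.
move=> zD uP H3.
have z1 i : N (tnth z i) < 1 by have [] := zD i.
have z1' i : `|tnth z i| < 1 by rewrite diskE.
have [|||||h1 h2] := @pickS_psd3 R L f n z sL (pickS f z) (J_a f z) (J_b f z)
  (fun j => J_alpha f z j 0) (fun j => J_beta f z j 0).
- by move=> y w y1 w1; apply: pickS_J; rewrite ?diskE.
- by move=> y y1 yz; apply: J_inv1; rewrite ?diskE.
- by move=> y y1 yz; apply: J_inv2; rewrite ?diskE.
- move=> y y1 Ly; apply: (H3 1%N) => // i; apply/LzP.
  by rewrite !ord1 /tnth.
- by move=> m m3 y uy yD; apply: (H3 m) => // i; apply/LzP.
split.
- by move=> m y uy yD; apply: h1 => // i; apply/LzP.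
- by move=> y yD yz; have [y1 Ly] := (LzP z y).2 (conj yD yz); apply: h2.
Qed.

Lemma pickS_psd2_all n (z : n.-tuple R[i]) E : sparse E ->
  L `|` [set x | x \in z] `<=` E -> (forall y, N y < 1 -> ~ E y -> C11 f y) ->
  (forall i, D (tnth z i)) -> kernel_mx K z \in unitmx ->
  (forall m, (m <= 2)%N -> pickS_psd z m) -> forall m, pickS_psd z m.
Proof.
move=> sE LE fC zD uP H2.
have z1 i : N (tnth z i) < 1 by have [] := zD i.
have z1' i : `|tnth z i| < 1 by rewrite diskE.
have h := @pickS_psd2 R L f n z sL z1 (pickS f z) (J_a f z) (J_b f z)
  (fun j => J_alpha f z j 0) (fun j => J_beta f z j 0) (fun=> erefl) (fun=> erefl).
move=> m y uy yD; apply: (h _ _ _ E) => //.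
- by move=> y' w y1 w1; apply: pickS_J; rewrite ?diskE.
- by move=> y' y1 yz; apply: J_inv1; rewrite ?diskE.
- move=> y' y1 Ly; apply: (H2 1%N) => // i; apply/LzP.
  by rewrite !ord1 /tnth.
- by move=> k k2 y' uy' yD'; apply: (H2 k) => // i; apply/LzP.
- by move=> i; apply/LzP.
Qed.

(** By [kn_has_neg] and [kn_ge] this amounts to k <= k_n(f); as a lower bound it is monotone in both
    n and k. *)
Definition has_neg n k := exists z : n.-tuple R[i],
  [/\ uniq z, forall i, D (tnth z i) & negsq (kernel_mx K z) k].

Lemma fresh_point (s : seq R[i]) : exists2 x, D x & x \notin s.
Proof.
have [|r r0 hr] := sparseUseq s sL (w := 0); first by rewrite cnorm0.
pose t := Num.min r 1 / 2.
have m0 : 0 < Num.min r 1 by rewrite lt_min r0 ltr01.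
have t0 : 0 < t by rewrite /t; lra.
have mr : Num.min r 1 <= r by rewrite ge_min lexx.
have m1 : Num.min r 1 <= 1 by rewrite ge_min lexx orbT.
have tr : t < r by rewrite /t; lra.
have t1 : t < 1 by rewrite /t; lra.
have nt : N t%:C%C = t by rewrite cnorm_real gtr0_norm.
have E0 : ~ (L `|` [set x | x \in s]) t%:C%C.
  move=> /hr; rewrite subr0 nt -cnorm_eq0 nt lt0r_neq0// => /(_ isT).
  by move: tr; lra.
exists t%:C%C; first by split; [rewrite nt|move=> ?; apply: E0; left].
by apply/negP => ?; apply: E0; right.
Qed.

Lemma has_neg_extend n m k : (n <= m)%N -> has_neg n k -> has_neg m k.
Proof.
move=> /subnKC <-; elim: (m - n)%N => [|d IH] /= h; first by rewrite addn0.
have [z [uz zD hz]] := IH h; have [x xD xz] := fresh_point z.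
rewrite addnS; exists [tuple of x :: z]; split.
- by rewrite /= xz.
- by move=> i; case: (unliftP ord0 i) => [j ->|->]; rewrite ?tnthS ?tnth0.
- by apply: negsq_subset hz => y yz; rewrite inE yz orbT.
Qed.

Lemma has_neg_add n m k (z : n.-tuple R[i]) (y : m.-tuple R[i]) :
  uniq z -> (forall i, D (tnth z i)) -> kernel_mx K z \in unitmx ->
  negsq (kernel_mx K z) k -> uniq y ->
  (forall i, D (tnth y i) /\ tnth y i \notin z) ->
  ~ psd (kernel_mx (pickS f z) y) -> has_neg (n + m) k.+1.
Proof.
move=> uz zD uP hz uy yD /not_psd[|v hv].
  by apply: kernel_mx_herm; apply: pickS_conj.
exists [tuple of z ++ y]; split.
- rewrite cat_uniq uz uy andbT; apply/hasPn => x /tnthP[i ->].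
  by have [] := yD i.
- move=> i; case: (split_ordP i) => j ->; rewrite ?tnth_lshift ?tnth_rshift//.
  by have [] := yD j.
- have hP := kernel_mx_herm z (pickK_conj f).
  rewrite pick_cat -addn1; apply: (negsq_block_add (v := v) hP uP hz).
  by rewrite pick_schurE.
Qed.

(** Enlarge [y] to [z] followed by the points of [y] outside [z]; positivity of the Schur complement
    then brings all negative squares down to [z]. *)
Lemma negsq_of_schur_psd n m k (z : n.-tuple R[i]) (y : m.-tuple R[i]) :
  kernel_mx K z \in unitmx -> (forall p, pickS_psd z p) ->
  uniq y -> (forall i, D (tnth y i)) -> negsq (kernel_mx K y) k ->
  negsq (kernel_mx K z) k.
Proof.
move=> uP H uy yD hy; pose w := in_tuple [seq x <- y | x \notin z].
have : negsq (kernel_mx K [tuple of z ++ w]) k.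
  apply: negsq_subset hy => x xy; rewrite mem_cat mem_filter xy andbT.
  by case: (x \in z).
rewrite pick_cat; apply: negsq_block_psd => //.
  by apply: kernel_mx_herm; apply: pickK_conj.
rewrite pick_schurE; apply: H; first by rewrite filter_uniq.
move=> i; have := mem_tnth i w; rewrite mem_filter => /andP[-> /tnthP[j ->]].
by split.
Qed.

(** Failure of positivity of the Schur complement on at most 3 points would give kappa + 1 negative
    squares on at most 2 kappa + 3 points. *)
Lemma has_neg_bound3 kappa :
  has_neg (2 * kappa) kappa -> (forall k, has_neg (2 * kappa + 3) k -> (k <= kappa)%N) ->
  forall n k, has_neg n k -> (k <= kappa)%N.
Proof.
move=> [z0 [uz0 z0D hz0]] ub n k [y [uy yD hy]].
have [m [z [mn uz zz0 hz uP]]] := negsq_unit_subtuple (pickK_conj f) uz0 hz0.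
have zD i : D (tnth z i).
  by have /zz0/tnthP[j ->] := mem_tnth i z.
have [|Hall _] := pickS_psd3_all zD uP.
  move=> p p3 w uw wD; apply: contrapT => np.
  have /ub : has_neg (2 * kappa + 3) kappa.+1.
    by apply: has_neg_extend (has_neg_add uz zD uP hz uw wD np); apply: leq_add.
  by rewrite ltnn.
apply: ub; apply: (@has_neg_extend m); first exact: leq_trans (leq_addr _ _).
by exists z; split => //; apply: negsq_of_schur_psd hy.
Qed.

Lemma has_neg_2kappa kappa n0 : has_neg n0 kappa ->
  (forall n k, has_neg n k -> (k <= kappa)%N) -> has_neg (2 * kappa) kappa.
Proof.
move=> [z0 [uz0 z0D hz0]] ub.
have [m1 [z1 [_ uz1 z1z0 hz1 uP1]]] := negsq_unit_subtuple (pickK_conj f) uz0 hz0.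
have z1D i : D (tnth z1 i).
  by have /z1z0/tnthP[j ->] := mem_tnth i z1.
have [|_ fC] := pickS_psd3_all z1D uP1.
  move=> p _ w uw wD; apply: contrapT => np.
  by have /ub := has_neg_add uz1 z1D uP1 hz1 uw wD np; rewrite ltnn.
suff : forall j, (j <= kappa)%N -> has_neg (2 * j) j by exact.
elim=> [_|j IH jk].
  exists [tuple]; split => // [[]//|]; exists 0 => x.
  by rewrite thinmx0 eqxx.
have [z2 [uz2 z2D hz2]] := IH (ltnW jk).
have [m [z [mn uz zz2 hz uP]]] := negsq_unit_subtuple (pickK_conj f) uz2 hz2.
have zD i : D (tnth z i).
  by have /zz2/tnthP[l ->] := mem_tnth i z.
(* Either two more points add a negative square, or the complement is positive and [z], with at most
   2j points, already carries all kappa squares. *)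
have [H2|] := pselect (forall p, (p <= 2)%N -> pickS_psd z p); last first.
  move=> /existsNP[p /not_implyP[p2 /existsNP[w /not_implyP[uw /not_implyP[wD np]]]]].
  apply: has_neg_extend (has_neg_add uz zD uP hz uw wD np).
  by rewrite mulnS addnC leq_add.
pose E := L `|` [set x | x \in z] `|` [set x | x \in z1].
have sE : sparse E by do 2!apply: sparseUseq.
have fE y : N y < 1 -> ~ E y -> C11 f y.
  move=> y1 Ey; apply: fC; first by split => // Ly; apply: Ey; left; left.
  by apply/negP => yz; apply: Ey; right.
have Hall := pickS_psd2_all sE (@subsetUl _ _ _) fE zD uP H2.
apply: (@has_neg_extend m).
  by rewrite mulnS; apply: leq_trans mn _; rewrite leq_addl.
exists z; split => //; apply: negsq_le jk _.
exact: negsq_of_schur_psd hz1.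
Qed.

End NegativeSquares.

(** * From negative squares to [kn] and the theorem *)

Lemma sq_minus_le (R : realType) n (P : 'M[R[i]]_n) : P^t* = P -> (sq_minus P <= n)%N.
Proof.
move=> hP; rewrite sq_minus_spectral; last first.
  by apply/hermitian_normalmx/is_hermitianmxP; rewrite expr0 scale1r hP.
by rewrite -[leqRHS]card_ord max_card.
Qed.

Lemma diskDE (R : realType) (L : set R[i]) x :
  (disk R `\` L) x <-> cnorm x < 1 /\ ~ L x.
Proof. by rewrite /disk /= diskE. Qed.

Lemma kn_has_neg (R : realType) (L : set R[i]) f n :
  sparse L -> has_neg L f n (kn (disk R `\` L) f n).
Proof.
move=> sL; rewrite /kn.
pose P : pred 'I_n.+1 := fun k => `[< pick_attains (disk R `\` L) f n k >].
have [P0|] := ltnP 0 #|P|.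
  have [k Pk ->] := eq_bigmax_cond (fun k : 'I_n.+1 => k : nat) P0.
  move: Pk => /asboolP[z [uz zD hk]]; exists z; split => //.
    by move=> i; apply/diskDE.
  by apply/sq_minusP; rewrite ?pick_herm// hk.
(* A maximum over no index is 0, and 0 negative squares are present on any number of points. *)
rewrite leqn0 => /eqP/card0_eq P0; rewrite big_pred0//.
apply: (@has_neg_extend _ _ _ sL 0) => //; exists [tuple]; split => // [[]//|].
by exists 0 => x; rewrite thinmx0 eqxx.
Qed.

Lemma kn_ge (R : realType) (L : set R[i]) f n k :
  has_neg L f n k -> (k <= kn (disk R `\` L) f n)%N.
Proof.
move=> [z [uz zD hz]].
have hk : (k <= sq_minus (pick_mx f z))%N by apply/sq_minusP; rewrite ?pick_herm.
apply: leq_trans hk _.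
(* The maximum in [kn] ranges over values at most n, so the value at [z] must be shown to lie in
   that range. *)
have lt : (sq_minus (pick_mx f z) < n.+1)%N by rewrite ltnS sq_minus_le ?pick_herm.
rewrite /kn; apply: (leq_bigmax_cond (Ordinal lt)).
by apply/asboolP; exists z; split => // i; apply/diskDE.
Qed.

Theorem theorem1p11 (R : realType) (L : set R[i]) (f : R[i] -> R[i])
    (kappa : nat) :
  discrete_set L ->
  ((kn (disk R `\` L) f (2 * kappa) = kappa ->
    kn (disk R `\` L) f (2 * kappa + 3) = kappa ->
    in_S (disk R `\` L) f kappa)
   /\
   (in_S (disk R `\` L) f kappa ->
    kn (disk R `\` L) f (2 * kappa) = kappa)).
Proof.
move=> dL; have sL := discrete_sparse dL; split=> [k2 k3|[_ ub [n [z [uz zD hz]]]]].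
  have h2 : has_neg L f (2 * kappa) kappa.
    by rewrite -[X in has_neg _ _ _ X]k2; apply: kn_has_neg.
  have ub : forall n k, has_neg L f n k -> (k <= kappa)%N.
    by apply: has_neg_bound3 => // k hk; rewrite -k3; apply: kn_ge.
  have ub' n (z : n.-tuple R[i]) : uniq z -> (forall i, (disk R `\` L) (tnth z i)) ->
      (sq_minus (pick_mx f z) <= kappa)%N.
    move=> uz zD; apply: (ub n); exists z; split => // [i|]; first exact/diskDE.
    by apply/sq_minusP; rewrite ?pick_herm.
  split=> //; first by exists L.
  have [z [uz zD hz]] := h2; exists (2 * kappa)%N, z.
  have zD' i : (disk R `\` L) (tnth z i) by apply/diskDE.
  split => //; apply/eqP; rewrite eqn_leq ub'//=.
  by apply/sq_minusP; rewrite ?pick_herm.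
have ub' m k : has_neg L f m k -> (k <= kappa)%N.
  move=> [y [uy yD hy]]; apply: leq_trans (ub m y uy _); last by move=> i; apply/diskDE.
  by apply/sq_minusP; rewrite ?pick_herm.
apply/eqP; rewrite eqn_leq (ub' (2 * kappa)%N)/=; last exact: kn_has_neg.
apply: kn_ge.
apply: (@has_neg_2kappa _ _ _ sL _ n) => //.
exists z; split => // [i|]; first exact/diskDE.
by apply/sq_minusP; rewrite ?pick_herm// hz.
Qed.
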